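(* For every fixed $u\in\mathbb{R}$, $$\lim_{n\to\infty}n^{1/12}\,\Psi_n\big(2\sqrt n+n^{-1/6}u\big)=\mathrm{Ai}(u)\qquad\text{and}\qquad \lim_{n\to\infty}n^{-1/12}\,\Psi_n'\big(2\sqrt n+n^{-1/6}u\big)=\mathrm{Ai}'(u).$$
   Context: $He_n(x)=\mathbb{E}_{Z\sim\mathcal{N}(0,1)}[(x+\imath Z)^n]$ ($\imath=\sqrt{-1}$) is the probabilist's Hermite polynomial and $\Psi_n(x)=\frac{1}{\sqrt{n!}}He_n(x)\sqrt{\frac{1}{\sqrt{2\pi}}e^{-\frac12x^2}}$ is the normalized oscillator wave function. $\mathrm{Ai}$ is the Airy function, $\mathrm{Ai}(u)=\frac{1}{2\pi \imath}\int_{\mathcal C}\exp\{\frac{t^3}{3}-ut\}\,dt$, where $\mathcal C$ consists of the two rays from the origin at angles $-\pi/3$ and $\pi/3$, oriented from $e^{-\imath\pi/3}\infty$ to $e^{\imath\pi/3}\infty$. *)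

(* Defs.v *)
From HB Require Import structures.
From mathcomp Require Export all_boot all_order all_algebra.
From mathcomp Require Export all_classical all_reals all_analysis.
From mathcomp Require Export complex.

Set Implicit Arguments.
Unset Strict Implicit.
Unset Printing Implicit Defensive.

Import Order.TTheory GRing.Theory Num.Theory.
Import numFieldNormedType.Exports.

Local Open Scope classical_set_scope.
Local Open Scope complex_scope.
Local Open Scope ring_scope.

Definition cexpectation {R : realType} {d} {T : measurableType d}
    (P : probability T R) (X : T -> R[i]) : R[i] :=
  fine 'E_P[fun w => complex.Re (X w)] +i*
  fine 'E_P[fun w => complex.Im (X w)].

(* [x +i* z] is the complex number with real part x and imaginary part z;
   the random variable Z is the identity on R, equipped with N(0,1). *)
Definition hermite {R : realType} (n : nat) (x : R) : R[i] :=
  cexpectation (normal_prob (0 : R) 1) (fun z : R => (x +i* z) ^+ n).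

(* [hermite n x] is real because N(0,1) is symmetric, so taking its real part
   only changes the type. *)
Definition oscillator {R : realType} (n : nat) (x : R) : R :=
  (Num.sqrt (n`!)%:R)^-1 * complex.Re (hermite n x) *
  Num.sqrt ((Num.sqrt (2 * pi))^-1 * expR (- (2^-1 * x ^+ 2))).

Definition cexp {R : realType} (z : R[i]) : R[i] :=
  (expR (complex.Re z))%:C *
  (cos (complex.Im z) +i* sin (complex.Im z)).

(* Integral of f along t = r e^(i a), r from 0 to +oo (so dt = e^(i a) dr). *)
Definition ray_integral {R : realType} (a : R) (f : R[i] -> R[i]) : R[i] :=
  let e : R[i] := cexp (0 +i* a) in
  (\int[lebesgue_measure]_(r in `[0, +oo[)
     complex.Re (f (r%:C * e) * e)) +i*
  (\int[lebesgue_measure]_(r in `[0, +oo[)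
     complex.Im (f (r%:C * e) * e)).

(* The ray at angle - pi / 3 is travelled towards the origin, hence the sign. *)
Definition airy_contour {R : realType} (u : R) : R[i] :=
  let F (t : R[i]) := cexp (t ^+ 3 / 3 - u%:C * t) in
  (2 * pi%:C * (0 +i* 1))^-1 *
  (ray_integral (pi / 3) F - ray_integral (- (pi / 3)) F).

(* The two rays are exchanged by complex conjugation, so [airy_contour u] is
   real and taking its real part only changes the type. *)
Definition airy {R : realType} (u : R) : R := complex.Re (airy_contour u).

(* Main.v *)
Require Import Defs.
From mathcomp Require Import ring lra measurable_realfun.

(** This is the method of steepest descent at a double critical point.

    Up to constants, He_n(x) is the integral of F(w) = w^n exp((w - x)^2 / 2) over
    the line Re w = x.  When x is close to 2 sqrt n, the first two derivatives of
    the exponent n log w + (w - x)^2 / 2 both vanish, to leading order, at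
    w = sqrt n.  The line is therefore deformed into the two rays that issue from
    sqrt n at the angles +pi/3 and -pi/3, on which the cubic term of the exponent
    is real and negative.  The rays are complex conjugate, so one of them suffices:
    He_n(x) becomes the imaginary part of an absolutely convergent integral over
    the half-line, by [Re_hermite_contour].  The deformation is an instance of
    Cauchy's theorem and is proved by differentiating in the parameter of a homotopy
    between rays: the derivative is an exact differential whose boundary value is
    real.

    Put kappa = n^(1/6), eps = kappa^(-2), omega = exp(i pi/3), and
    w = kappa^3 + kappa r omega, x = 2 kappa^3 + u / kappa.  Then F(w) exp(- x^2 / 4)
    is an explicit scalar times G(r) exp(- u r omega), where
      G(r) = (1 + eps r omega)^n exp(- n eps r omega + n eps^2 r^2 omega^2 / 2)
    ([hermite_integrand_scaled]).  Because omega^3 = -1 and n eps^3 = 1, one has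
      G'(r) = - r^2 G(r) / (1 + eps r omega),
    so that G tends to exp(- r^3 / 3), the Airy integrand on the ray
    ([scaled_integrand_lim]).  An elementary inequality gives
    |G(r)| <= exp(- (r^2 - r) / 16) for every n ([normc_scaled_gauss]), and
    dominated convergence yields the limit of the integrals.

    The derivative is handled on the same contour: He_n' = n He_(n-1), and
    n w^(n-1) - (x / 2) w^n is w^n multiplied by a factor close to
    - kappa r omega, which is the factor that differentiation in u produces in the
    Airy integral ([is_derive_airy]).

    The scalars are controlled by Stirling's formula, which [stirling] derives from
    n! = 2 int_0^oo t^(2n+1) exp(- t^2) dt: after the shift t = sqrt n + s, the
    integrand divided by its value at s = 0 converges to exp(- 2 s^2), and it is
    dominated by (1 + |s|) exp(- s^2). *)

Set Implicit Arguments.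
Unset Strict Implicit.
Unset Printing Implicit Defensive.

Import Order.TTheory GRing.Theory Num.Theory.
Import numFieldNormedType.Exports.

Local Open Scope classical_set_scope.
Local Open Scope complex_scope.
Local Open Scope ring_scope.

Local Notation normc := ComplexField.Normc.normc.

(** * Complex functions of a real variable *)

Section Complex.
Variable R : realType.
Implicit Types (x y r t : R) (z w : R[i]).

Lemma cReD z w : complex.Re (z + w) = complex.Re z + complex.Re w.
Proof. by case: z w => [? ?] []. Qed.
Lemma cImD z w : complex.Im (z + w) = complex.Im z + complex.Im w.
Proof. by case: z w => [? ?] []. Qed.
Lemma cReN z : complex.Re (- z) = - complex.Re z.
Proof. by case: z. Qed.
Lemma cImN z : complex.Im (- z) = - complex.Im z.
Proof. by case: z. Qed.
Lemma cReB z w : complex.Re (z - w) = complex.Re z - complex.Re w.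
Proof. by rewrite cReD cReN. Qed.
Lemma cImB z w : complex.Im (z - w) = complex.Im z - complex.Im w.
Proof. by rewrite cImD cImN. Qed.
Lemma cReM z w :
  complex.Re (z * w) =
    complex.Re z * complex.Re w - complex.Im z * complex.Im w.
Proof. by case: z w => [? ?] []. Qed.
Lemma cImM z w :
  complex.Im (z * w) =
    complex.Re z * complex.Im w + complex.Im z * complex.Re w.
Proof. by case: z w => [? ?] []. Qed.
Lemma Re_real x : complex.Re x%:C = x. Proof. by []. Qed.
Lemma Im_real x : complex.Im x%:C = 0. Proof. by []. Qed.
Lemma cReZ x z : complex.Re (x%:C * z) = x * complex.Re z.
Proof. by rewrite cReM /= mul0r subr0. Qed.
Lemma cImZ x z : complex.Im (x%:C * z) = x * complex.Im z.
Proof. by rewrite cImM /= mul0r addr0. Qed.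

Lemma complex_eq z w :
  complex.Re z = complex.Re w -> complex.Im z = complex.Im w -> z = w.
Proof. by case: z w => [? ?] [? ?] /= -> ->. Qed.

Lemma cexpD z w : cexp (z + w) = cexp z * cexp w.
Proof.
rewrite /cexp cReD cImD expRD cosD sinD.
by apply: complex_eq; rewrite ?cReM ?cImM /=; ring.
Qed.

Lemma cexp_real x : cexp x%:C = (expR x)%:C.
Proof. by rewrite /cexp /= cos0 sin0 mulr1. Qed.

Lemma cexp0 : cexp (0 : R[i]) = 1.
Proof. by rewrite (cexp_real 0) expR0. Qed.

Lemma normc_ge0 z : 0 <= normc z.
Proof. by case: z => a b /=; exact: sqrtr_ge0. Qed.

Lemma normc_sqr z : normc z ^+ 2 = complex.Re z ^+ 2 + complex.Im z ^+ 2.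
Proof. by case: z => a b /=; rewrite sqr_sqrtr// addr_ge0// sqr_ge0. Qed.

Lemma normcM z w : normc (z * w) = normc z * normc w.
Proof. exact: ComplexField.Normc.normcM. Qed.

Lemma normcX z k : normc (z ^+ k) = normc z ^+ k.
Proof.
elim: k => [|k IH]; first exact: ComplexField.Normc.normc1.
by rewrite !exprS normcM IH.
Qed.

Lemma normcV z : normc z^-1 = (normc z)^-1.
Proof. exact: ComplexField.Normc.normcV. Qed.

Lemma normcD z w : normc (z + w) <= normc z + normc w.
Proof. by have := ler_normD z w; rewrite lecE /= => /andP[]. Qed.

Lemma normcN z : normc (- z) = normc z.
Proof. by case: z => a b /=; rewrite !sqrrN. Qed.

Lemma normc_real x : normc x%:C = `|x|.
Proof. by rewrite /= expr0n/= addr0 sqrtr_sqr. Qed.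

Lemma normc_nat n : normc (n%:R : R[i]) = n%:R.
Proof. by rewrite -(rmorph_nat (real_complex R)) normc_real normr_nat. Qed.

Lemma normc_Re z : `|complex.Re z| <= normc z.
Proof.
rewrite -(@ler_pXn2r _ 2)// ?nnegrE ?normc_ge0//.
by rewrite normc_sqr real_normK ?num_real// lerDl sqr_ge0.
Qed.

Lemma normc_Im z : `|complex.Im z| <= normc z.
Proof.
rewrite -(@ler_pXn2r _ 2)// ?nnegrE ?normc_ge0//.
by rewrite normc_sqr real_normK ?num_real// lerDr sqr_ge0.
Qed.

Lemma normc_cexp z : normc (cexp z) = expR (complex.Re z).
Proof.
by rewrite normcM normc_real /= cos2Dsin2 sqrtr1 mulr1 ger0_norm ?expR_ge0.
Qed.

(** [R[i]] carries no normed module structure over [R], so differentiability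
    along the real line is taken one component at a time. *)
Definition is_cderive (f : R -> R[i]) t (l : R[i]) :=
  is_derive t 1 (fun s => complex.Re (f s)) (complex.Re l) /\
  is_derive t 1 (fun s => complex.Im (f s)) (complex.Im l).

Lemma is_deriveM_fun (f g : R -> R) t (df dg : R) :
  is_derive t 1 f df -> is_derive t 1 g dg ->
  is_derive t 1 (fun s => f s * g s) (df * g t + f t * dg).
Proof.
move=> hf hg; apply: (is_derive_eq (is_deriveM hf hg)).
by rewrite addrC /GRing.scale /= mulrC.
Qed.

Lemma is_deriveMcst (f : R -> R) t df c :
  is_derive t 1 f df -> is_derive t 1 (fun s => f s * c) (df * c).
Proof.
move=> hf; apply: (is_derive_eq (is_deriveM_fun hf (is_derive_cst c _ _))).
by rewrite mulr0 addr0.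
Qed.

Lemma is_derive_cstM (f : R -> R) t df c :
  is_derive t 1 f df -> is_derive t 1 (fun s => c * f s) (c * df).
Proof.
move=> hf; apply: (is_derive_eq (is_deriveM_fun (is_derive_cst c _ _) hf)).
by rewrite mul0r add0r.
Qed.

Lemma is_cderive_eq f t l l' : is_cderive f t l -> l = l' -> is_cderive f t l'.
Proof. by move=> ? <-. Qed.

Lemma is_cderive_cst z t : is_cderive (fun=> z) t 0.
Proof. by split; exact: is_derive_cst. Qed.

Lemma is_cderive_real (f : R -> R) t df :
  is_derive t 1 f df -> is_cderive (fun s => (f s)%:C) t df%:C.
Proof. by move=> ?; split => //=; exact: is_derive_cst. Qed.

Lemma is_cderive_id t : is_cderive (real_complex R) t 1.
Proof. exact: (is_cderive_real (is_derive_id _ _)). Qed.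

Lemma is_cderiveD f g t df dg : is_cderive f t df -> is_cderive g t dg ->
  is_cderive (fun s => f s + g s) t (df + dg).
Proof.
move=> [fR fI] [gR gI]; split.
- rewrite (_ : (fun s => _) = (fun s => complex.Re (f s)) + (fun s => complex.Re (g s))).
    by rewrite cReD; exact: is_deriveD.
  by apply/funext => s; rewrite cReD.
- rewrite (_ : (fun s => _) = (fun s => complex.Im (f s)) + (fun s => complex.Im (g s))).
    by rewrite cImD; exact: is_deriveD.
  by apply/funext => s; rewrite cImD.
Qed.

Lemma is_cderiveM f g t df dg : is_cderive f t df -> is_cderive g t dg ->
  is_cderive (fun s => f s * g s) t (df * g t + f t * dg).
Proof.
move=> [fR fI] [gR gI]; split.
- rewrite (_ : (fun s => _) =
    (fun s => complex.Re (f s) * complex.Re (g s))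
    - (fun s => complex.Im (f s) * complex.Im (g s))); last first.
    by apply/funext => s; rewrite cReM.
  apply: (is_derive_eq (is_deriveB (is_deriveM_fun fR gR) (is_deriveM_fun fI gI))).
  by rewrite !cReD !cReM; ring.
- rewrite (_ : (fun s => _) =
    (fun s => complex.Re (f s) * complex.Im (g s))
    + (fun s => complex.Im (f s) * complex.Re (g s))); last first.
    by apply/funext => s; rewrite cImM.
  apply: (is_derive_eq (is_deriveD (is_deriveM_fun fR gI) (is_deriveM_fun fI gR))).
  by rewrite !cImD !cImM; ring.
Qed.

Lemma is_cderiveMl z f t df : is_cderive f t df ->
  is_cderive (fun s => z * f s) t (z * df).
Proof.
move=> hf; apply: is_cderive_eq (is_cderiveM (is_cderive_cst z t) hf) _.
by rewrite mul0r add0r.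
Qed.

Lemma is_cderiveMr z f t df : is_cderive f t df ->
  is_cderive (fun s => f s * z) t (df * z).
Proof.
move=> hf; apply: is_cderive_eq (is_cderiveM hf (is_cderive_cst z t)) _.
by rewrite mulr0 addr0.
Qed.

Lemma is_cderiveX k f t df : is_cderive f t df ->
  is_cderive (fun s => f s ^+ k) t (k%:R * f t ^+ k.-1 * df).
Proof.
move=> hf; elim: k => [|k IH].
  by apply: (is_cderive_eq (is_cderive_cst _ _)); rewrite !mul0r.
rewrite (_ : (fun s => _) = fun s => f s * f s ^+ k); last first.
  by apply/funext => s; rewrite exprS.
apply: is_cderive_eq (is_cderiveM hf IH) _ => /=.
case: k {IH} => [|k] /=; first by rewrite expr0; ring.
by rewrite -[k.+2%:R]natr1 exprS; ring.
Qed.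

Lemma is_cderive_cexp f t df : is_cderive f t df ->
  is_cderive (fun s => cexp (f s)) t (df * cexp (f t)).
Proof.
move=> [fR fI]; rewrite /cexp.
have hc := is_derive1_comp (is_derive_cos (complex.Im (f t))) fI.
have hs := is_derive1_comp (is_derive_sin (complex.Im (f t))) fI.
have hE : is_cderive
    (fun s => cos (complex.Im (f s)) +i* sin (complex.Im (f s))) t
    ((- sin (complex.Im (f t)) * complex.Im df) +i*
      (cos (complex.Im (f t)) * complex.Im df)) by [].
have he := is_cderive_real (is_derive1_comp (is_derive_expR (complex.Re (f t))) fR).
apply: is_cderive_eq (is_cderiveM he hE) _.
by apply: complex_eq; rewrite ?cReD ?cImD ?cReM ?cImM /=; ring.
Qed.

Lemma is_derive_continuous (f df : R -> R) :
  (forall t : R, is_derive t 1 f (df t)) -> continuous f.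
Proof.
move=> h x; apply: differentiable_continuous; apply/derivable1_diffP.
by case: (h x).
Qed.

(** All integrands below are smooth, and this predicate is how their continuity
    and measurability are obtained without naming any derivative. *)
Definition cderivable (f : R -> R[i]) := forall t, exists l, is_cderive f t l.

Lemma is_cderive_cderivable (f df : R -> R[i]) :
  (forall t, is_cderive f t (df t)) -> cderivable f.
Proof. by move=> h t; exists (df t). Qed.

Lemma cderivable_continuous f : cderivable f ->
  continuous (fun t => complex.Re (f t)) /\
  continuous (fun t => complex.Im (f t)).
Proof.
move=> /choice[df h].
split.
- exact: (@is_derive_continuous _ (fun t => complex.Re (df t)) (fun t => proj1 (h t))).
- exact: (@is_derive_continuous _ (fun t => complex.Im (df t)) (fun t => proj2 (h t))).
Qed.

Lemma cderivable_cst z : cderivable (fun=> z).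
Proof. by move=> t; exists 0; exact: is_cderive_cst. Qed.

Lemma cderivable_id : cderivable (real_complex R).
Proof. by move=> t; exists 1; exact: is_cderive_id. Qed.

Lemma cderivableD f g : cderivable f -> cderivable g ->
  cderivable (fun s => f s + g s).
Proof.
by move=> hf hg t; have [? ?] := hf t; have [? ?] := hg t; eexists; apply: is_cderiveD; eassumption.
Qed.

Lemma cderivableM f g : cderivable f -> cderivable g ->
  cderivable (fun s => f s * g s).
Proof.
by move=> hf hg t; have [? ?] := hf t; have [? ?] := hg t; eexists; apply: is_cderiveM; eassumption.
Qed.

Lemma cderivableX k f : cderivable f -> cderivable (fun s => f s ^+ k).
Proof. by move=> hf t; have [? ?] := hf t; eexists; apply: is_cderiveX; eassumption. Qed.

End Complex.

(** * Integrals dominated by a decaying exponential *)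

Section ExpDominated.
Variable R : realType.
Implicit Types (C : R) (D : set R) (f F : R -> R).
Local Notation mu := (@lebesgue_measure R).

Lemma continuous_expRNabs : continuous (fun x : R => expR (- `|x|)).
Proof.
move=> x; apply: (continuous_comp (f := fun x : R => - `|x|)).
  by apply: continuousN; exact: norm_continuous.
exact: continuous_expR.
Qed.

(** The single integrable majorant used throughout: every integrand below is
    bounded by a constant times it, on the line or on a half-line. *)
Lemma integrable_expRNabs : mu.-integrable [set: R] (EFin \o fun x : R => expR (- `|x|)).
Proof.
have mf : measurable_fun setT (EFin \o fun x : R => expR (- `|x|)).
  apply/measurable_EFinP; apply: continuous_measurable_fun.
  exact: continuous_expRNabs.
apply/integrableP; split => //.
under eq_integral do rewrite /= ger0_norm ?expR_ge0//.
rewrite ge0_symfun_integralT; first last.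
- by move=> x /=; rewrite normrN.
- exact: continuous_expRNabs.
- by move=> x; exact: expR_ge0.
rewrite (_ : [set x | _] = `[0, +oo[%classic); last first.
  by apply/seteqP; split => x/=; rewrite in_itv/= andbT.
rewrite lte_mul_pinfty//.
have pI : mu.-integrable [set: R] (EFin \o exponential_pdf 1).
  exact: integrable_exponential_pdf.
have : mu.-integrable `[0, +oo[%classic (EFin \o exponential_pdf 1).
  exact: (integrableS measurableT _ (@subsetT _ _) pI).
move/integrableP => [_ pI2]; apply: le_lt_trans pI2.
apply: ge0_le_integral => //=.
- exact: measurable_funTS.
- apply: measurable_funTS; apply/measurable_EFinP; apply: measurableT_comp => //.
  exact: measurable_exponential_pdf.
- move=> x; rewrite in_itv/= andbT => x0.
  by rewrite lee_fin exponential_pdfE// mul1r mulN1r (ger0_norm x0) ler_norm.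
Qed.

Lemma integrable_dom_expR D (mD : measurable D) C :
  mu.-integrable D (EFin \o fun x : R => C * expR (- `|x|)).
Proof.
have h : mu.-integrable [set: R] (EFin \o fun x : R => C * expR (- `|x|)).
  exact: (integrableZl measurableT C integrable_expRNabs).
by apply: (integrableS _ _ _ h).
Qed.

Lemma expR_dominated_integrable D f C : measurable D -> measurable_fun D f ->
  (forall x, D x -> `|f x| <= C * expR (- `|x|)) ->
  mu.-integrable D (EFin \o f).
Proof.
move=> mD mf fC; apply: (le_integrable _ _ _ (integrable_dom_expR mD C)) => //.
  exact/measurable_EFinP.
by move=> x Dx /=; rewrite lee_fin (le_trans (fC _ Dx))// ler_norm.
Qed.

Lemma expR_dominated_cvg D (f_ : nat -> R -> R) f C : measurable D ->
  (forall n, measurable_fun D (f_ n)) ->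
  (forall n x, D x -> `|f_ n x| <= C * expR (- `|x|)) ->
  (forall x, D x -> f_ n x @[n --> \oo] --> f x) ->
  \int[mu]_(x in D) f_ n x @[n --> \oo] --> \int[mu]_(x in D) f x.
Proof.
move=> mD mf_ f_C f_f; apply: fine_cvg; rewrite fineK.
  apply: (@dominated_cvg _ _ _ mu _ mD (fun n x => (f_ n x)%:E) _
    (EFin \o fun x : R => C * expR (- `|x|))) => //.
  - by move=> n; apply/measurable_EFinP; exact: mf_.
  - by move=> x Dx; apply: cvg_EFin; [exact: nearW|exact: f_f].
  - exact: integrable_dom_expR.
apply: integrable_fin_num => //.
apply: (@expR_dominated_integrable _ _ C mD).
  exact: (measurable_fun_cvg _ f_f).
move=> x Dx; apply: (ler_cvg_to (cvg_norm (f_f _ Dx)) (@cvg_cst _ _ _ _ _)).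
by apply: nearW => n; exact: f_C.
Qed.

(** The integrals over [[a, a + n + 1]] converge to the improper one by domination,
    and the boundary term at [a + n + 1] inherits the exponential decay. *)
Lemma expR_dominated_FTC (a : R) F f C :
  (forall x : R, is_derive x 1 F (f x)) -> continuous f ->
  (forall x, a <= x -> `|f x| <= C * expR (- `|x|)) ->
  (forall x, a <= x -> `|F x| <= C * expR (- `|x|)) ->
  \int[mu]_(x in `[a, +oo[) f x = - F a.
Proof.
move=> dF cf fC FC.
have cF : continuous F.
  move=> x; apply: differentiable_continuous; apply/derivable1_diffP.
  by case: (dF x).
have mf : measurable_fun [set: R] f by exact: continuous_measurable_fun.
pose b n : R := a + n.+1%:R.
have ab n : a < b n by rewrite /b ltrDl.
have h n : \int[mu]_(x in `[a, +oo[) (f \_ `[a, b n]) x = F (b n) - F a.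
  rewrite -Rintegral_mkcondr (_ : _ `&` _ = `[a, b n]%classic); last first.
    apply/seteqP; split => x /=; rewrite !in_itv/= ?andbT; first by case.
    by move=> /[dup] /andP[].
  rewrite /Rintegral (@continuous_FTC2 _ _ F)//.
  - exact: continuous_subspaceT.
  - split.
    + by move=> x _; case: (dF x).
    + exact/cvg_at_right_filter/cF.
    + exact/cvg_at_left_filter/cF.
  - by move=> x _; rewrite derive1E derive_val.
have Fb0 : F (b n) @[n --> \oo] --> (0 : R).
  apply: norm_cvg0.
  apply: (@squeeze_cvgr _ _ _ _ (cst 0) (fun n => (C * expR (- a)) * harmonic n)).
  - apply: nearW => n; rewrite normr_ge0/= (le_trans (FC _ (ltW (ab n))))//.
    have C0 : 0 <= C.
      have := le_trans (normr_ge0 _) (FC _ (lexx a)).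
      by rewrite pmulr_lge0// expR_gt0.
    rewrite -mulrA ler_wpM2l//.
    rewrite (@le_trans _ _ (expR (- b n)))//; first by rewrite ler_expR lerN2 ler_norm.
    rewrite /b opprD expRD ler_wpM2l ?expR_ge0// expRN /harmonic/=.
    rewrite lef_pV2 ?posrE ?expR_gt0//.
    by rewrite (le_trans _ (expR_ge1Dx _))// lerDr.
  - exact: cvg_cst.
  - rewrite -(mulr0 (C * expR (- a))); apply: cvgMr => //; exact: cvg_harmonic.
have l1 : F (b n) - F a @[n --> \oo] --> - F a.
  by rewrite -[X in _ --> X]sub0r; apply: cvgB => //; exact: cvg_cst.
apply: (@cvg_unique _ _ (F (b n) - F a @[n --> \oo])) l1 => //.
rewrite -(_ : (fun n => \int[mu]_(x in `[a, +oo[) (f \_ `[a, b n]) x) = (fun n => F (b n) - F a)); last first.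
  by apply/funext => n; exact: h.
apply: (@expR_dominated_cvg _ _ _ C) => //.
- move=> n; apply: measurable_funTS; apply/(measurable_restrictT _ _).1 => //.
  exact: measurable_funTS mf.
- move=> n x; rewrite /= in_itv/= andbT => ax; rewrite patchE; case: ifPn => _.
    exact: fC.
  by rewrite normr0 (le_trans _ (fC _ ax)).
- move=> x; rewrite /= in_itv/= andbT => ax.
  apply: cvg_near_cst.
  exists (Num.truncn (x - a)) => // n /= xn.
  rewrite patchE ifT// inE/= in_itv/= ax/= /b -lerBlDl.
  by rewrite (le_trans (ltW (truncnS_gt _)))// ler_nat.
Qed.

(** Adding the even majorant to [f] makes it nonnegative, which reduces the
    claim to the nonnegative case. *)
Lemma expR_dominated_even f C : continuous f ->
  (forall x, `|f x| <= C * expR (- `|x|)) -> (forall x, f (- x) = f x) ->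
  \int[mu]_(x in [set: R]) f x = 2 * \int[mu]_(x in `[0, +oo[) f x.
Proof.
move=> cf fC ef.
pose e (x : R) : R := C * expR (- `|x|); pose g x := f x + e x.
have ce : continuous e.
  by move=> x; apply: cvgM; [exact: cvg_cst|exact: continuous_expRNabs].
have cg : continuous g by move=> x; apply: cvgD; [exact: cf|exact: ce].
have C0 : 0 <= C.
  by have := le_trans (normr_ge0 _) (fC 0); rewrite pmulr_lge0// expR_gt0.
have e0 x : 0 <= e x by rewrite mulr_ge0// expR_ge0.
have g0 x : 0 <= g x.
  by rewrite -lerBlDr sub0r; have := fC x; rewrite ler_norml => /andP[].
have ee x : e (- x) = e x by rewrite /e normrN.
have sym (h : R -> R) : continuous h -> (forall x, 0 <= h x) ->
   (forall x, h (- x) = h x) ->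
  mu.-integrable [set: R] (EFin \o h) ->
  \int[mu]_(x in [set: R]) h x = 2 * \int[mu]_(x in `[0, +oo[) h x.
  move=> ch h0 eh ih; rewrite /Rintegral ge0_symfun_integralT//; last by move=> x /=; rewrite eh.
  rewrite (_ : [set x | _] = `[0, +oo[%classic); last first.
    by apply/seteqP; split => x/=; rewrite in_itv/= andbT.
  rewrite fineM//; apply: integrable_fin_num => //.
  exact: (integrableS measurableT _ (@subsetT _ _) ih).
have fi D : measurable D -> mu.-integrable D (EFin \o f).
  move=> mD; apply: (@expR_dominated_integrable _ _ C) => //.
  apply: measurable_funTS; exact: continuous_measurable_fun.
have ei D : measurable D -> mu.-integrable D (EFin \o e).
  by move=> mD; exact: integrable_dom_expR.
have gi : mu.-integrable [set: R] (EFin \o g).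
  exact: (integrableD measurableT (fi _ measurableT) (ei _ measurableT)).
have eg x : g (- x) = g x by rewrite /g ef ee.
have := sym _ cg g0 eg gi.
have fT := fi _ measurableT; have eT := ei _ measurableT.
have f0 := fi _ (measurable_itv `[(0:R), +oo[).
have e0' := ei _ (measurable_itv `[(0:R), +oo[).
rewrite /g (RintegralD measurableT fT eT) (RintegralD _ f0 e0')//.
rewrite (sym _ ce e0 ee (ei _ measurableT)) mulrDr.
exact: addIr.
Qed.

Lemma is_derive_Rintegral D (f df : R -> R -> R) C (a u v : R) :
  measurable D -> u < a < v ->
  (forall x, u < x < v -> mu.-integrable D (EFin \o f x)) ->
  (forall x y, u < x < v -> D y -> is_derive x 1 (f ^~ y) (df x y)) ->
  (forall x y, u < x < v -> D y -> `|df x y| <= C * expR (- `|y|)) ->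
  is_derive a 1 (fun x => \int[mu]_(y in D) f x y) (\int[mu]_(y in D) df a y).
Proof.
move=> mD uav fi fdf dfC.
have Ia : `]u, v[%classic a by rewrite /= in_itv.
have d1 x y : u < x < v -> D y -> partial1of2 f x y = df x y.
  by move=> xuv Dy; have [_ <-] := fdf x y xuv Dy; rewrite partial1of2E.
have intf x : `]u, v[%classic x -> mu.-integrable D (EFin \o f x).
  by rewrite /= in_itv; exact: fi.
have derf1 x y : `]u, v[%classic x -> D y -> derivable (f ^~ y) x 1.
  by rewrite /= in_itv => xuv Dy; case: (fdf x y xuv Dy).
have G_ub x y : `]u, v[%classic x -> D y -> `|partial1of2 f x y| <= `|C| * expR (- `|y|).
  rewrite /= in_itv => xuv Dy; rewrite d1// (le_trans (dfC _ _ xuv Dy))//.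
  by rewrite ler_wpM2r ?expR_ge0// ler_norm.
have G0 (y : R) : 0 <= `|C| * expR (- `|y|) by rewrite mulr_ge0// expR_ge0.
have Gi := integrable_dom_expR mD `|C|.
apply: DeriveDef.
  exact: (@derivable_under_integral _ _ _ mu f D mD _ _ _ Ia intf derf1 _ G0 Gi G_ub).
rewrite -derive1E.
rewrite (@differentiation_under_integral _ _ _ mu f D mD _ _ _ Ia intf derf1 _ G0 Gi G_ub).
by apply: eq_Rintegral => y; rewrite inE => Dy; rewrite d1.
Qed.

End ExpDominated.

(** * Hermite polynomials as Gaussian integrals *)

Section Normal.
Variable R : realType.
Local Notation mu := (@lebesgue_measure R).
Local Notation P := (normal_prob (0 : R) 1).
Local Notation RN := (Radon_Nikodym_SigmaFinite.f P mu).

(* Uniqueness of the density, up to a null set *)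
Let ae_pdf : ae_eq mu [set: R] RN (EFin \o normal_pdf (0 : R) 1).
Proof.
have dom := @normal_prob_dominates R 0 1.
apply: integral_ae_eq => //.
- exact: Radon_Nikodym_SigmaFinite.f_integrable.
- apply/measurable_EFinP; exact: measurable_normal_pdf.
- move=> A _ mA; rewrite -(Radon_Nikodym_SigmaFinite.f_integral dom)//.
Qed.

Lemma ge0_integral_normal_prob (f : R -> \bar R) : (forall x, (0 <= f x)%E) ->
  measurable_fun [set: R] f ->
  (\int[P]_x f x = \int[mu]_x (f x * (normal_pdf 0 1 x)%:E))%E.
Proof.
move=> f0 mf.
have dom := @normal_prob_dominates R 0 1.
rewrite -(Radon_Nikodym_SigmaFinite.change_of_variables dom)//.
apply: ae_eq_integral => //.
- apply: emeasurable_funM => //; apply: (measurable_int mu).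
  exact: Radon_Nikodym_SigmaFinite.f_integrable.
- apply: emeasurable_funM => //; apply/measurable_EFinP.
  exact: measurable_normal_pdf.
- exact: ae_eqe_mul2l ae_pdf.
Qed.

Lemma expectation_normal_prob (f : R -> R) : measurable_fun [set: R] f ->
  fine ('E_P[f]) = \int[mu]_x (f x * normal_pdf 0 1 x).
Proof.
move=> mf; rewrite unlock /Rintegral; congr fine.
apply: etrans (integralE _ _ _) (etrans _ (esym (integralE _ _ _))).
have mfE : measurable_fun [set: R] (EFin \o f) by apply/measurable_EFinP.
congr (_ - _)%E.
- rewrite ge0_integral_normal_prob//; last exact: measurable_funepos.
  apply: eq_integral => x _.
  by rewrite !funeposE -EFin_max -EFinM maxr_pMl ?mul0r ?normal_pdf_ge0// -EFin_max.
- rewrite ge0_integral_normal_prob//; last exact: measurable_funeneg.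
  apply: eq_integral => x _.
  by rewrite !funenegE -!EFinN -!EFin_max -EFinM maxr_pMl ?mul0r ?normal_pdf_ge0 ?mulNr.
Qed.

Lemma quadratic_le_max (b d r : R) : 0 < d -> b * r - d * r ^+ 2 <= b ^+ 2 / (4 * d).
Proof.
move=> d0; rewrite ler_pdivlMr ?mulr_gt0//.
by have := sqr_ge0 (b - 2 * d * r); nra.
Qed.

(** Since [1 + r <= exp r], a power of [M (1 + r)] only shifts the linear
    coefficient of the Gaussian exponent. *)
Lemma poly_gauss_expR_dominated (M b d : R) m : 0 <= M -> 0 < d ->
  exists C, 0 <= C /\ forall r, 0 <= r ->
    (M * (1 + r)) ^+ m * expR (b * r - d * r ^+ 2) <= C * expR (- `|r|).
Proof.
move=> M0 d0; pose c := (m%:R + b + 1) ^+ 2 / (4 * d).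
exists (M ^+ m * expR c); split; first by rewrite mulr_ge0 ?exprn_ge0 ?expR_ge0.
move=> r r0; rewrite exprMn -!mulrA ler_wpM2l ?exprn_ge0//.
rewrite (@le_trans _ _ (expR (m%:R * r) * expR (b * r - d * r ^+ 2)))//.
  rewrite ler_wpM2r ?expR_ge0// expRM_natl.
  by rewrite lerXn2r ?nnegrE ?expR_ge0 ?addr_ge0// expR_ge1Dx.
rewrite -!expRD ler_expR ger0_norm//.
by have := @quadratic_le_max (m%:R + b + 1) d r d0; rewrite -/c; nra.
Qed.

(** The real part of the integrand of [hermite], without the constant of the
    normal density *)
Definition hermite_density k (x z : R) : R :=
  complex.Re ((x +i* z) ^+ k) * expR (- (2^-1 * z ^+ 2)).

Lemma normc_le_abs (x z : R) : normc (x +i* z) <= `|x| + `|z|.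
Proof.
rewrite -(@ler_pXn2r _ 2)// ?nnegrE ?addr_ge0 ?normc_ge0//.
rewrite normc_sqr/= sqrrD !real_normK ?num_real//.
by rewrite lerD2r lerDl mulrn_wge0// mulr_ge0.
Qed.

Lemma is_cderive_line (x z : R) : is_cderive (fun s => s +i* z) x 1.
Proof. by split; [exact: is_derive_id|exact: is_derive_cst]. Qed.

Lemma is_cderive_vline (x z : R) : is_cderive (fun s => x +i* s) z (0 +i* 1).
Proof. by split; [exact: is_derive_cst|exact: is_derive_id]. Qed.

Lemma continuous_hermite_density k x : continuous (hermite_density k x).
Proof.
have cd : cderivable (fun z => (x +i* z) ^+ k).
  by apply: cderivableX => t; exists (0 +i* 1); exact: is_cderive_vline.
move=> z; apply: cvgM; first by have [/(_ z)] := cderivable_continuous cd.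
apply: continuous_comp; last exact: continuous_expR.
by apply: cvgN; apply: cvgM; [exact: cvg_cst|exact: sqr_continuous].
Qed.

(** The bound is uniform for [x] in a compact set, as differentiation under the
    integral sign requires. *)
Lemma hermite_density_dominated k (M : R) : exists C, forall x z, `|x| <= M ->
  `|hermite_density k x z| <= C * expR (- `|z|).
Proof.
have h2 : 0 < 2^-1 :> R by rewrite invr_gt0.
have M0 : 0 <= `|M| + 1 by rewrite addr_ge0.
have [C [C0 hC]] := poly_gauss_expR_dominated 0 k M0 h2.
exists C => x z xM; rewrite normrM (ger0_norm (expR_ge0 _)).
have := hC `|z| (normr_ge0 z); rewrite normr_id mul0r sub0r real_normK ?num_real//.
apply: le_trans; rewrite ler_wpM2r ?expR_ge0//.
rewrite (le_trans (normc_Re _))// normcX.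
apply: lerXn2r; rewrite ?nnegrE ?normc_ge0 ?mulr_ge0 ?addr_ge0//.
rewrite (le_trans (normc_le_abs _ _))//.
have := ler_norm M; have := normr_ge0 z; have := normr_ge0 M; nra.
Qed.

Lemma Re_hermite k x : complex.Re (hermite k x) =
  normal_peak 1 * \int[mu]_(z in [set: R]) hermite_density k x z.
Proof.
have [C hC] := hermite_density_dominated k `|x|.
have cd : cderivable (fun z => (x +i* z) ^+ k).
  by apply: cderivableX => t; exists (0 +i* 1); exact: is_cderive_vline.
rewrite /hermite /cexpectation [LHS]/= expectation_normal_prob; last first.
  by apply: continuous_measurable_fun; have [] := cderivable_continuous cd.
rewrite -RintegralZl//.
  apply: eq_Rintegral => z _.
  rewrite normal_pdfE ?oner_neq0// /normal_fun /hermite_density subr0 expr1n.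
  rewrite mulrCA; congr (_ * (_ * expR _)); rewrite -mulr_natl mulr1; lra.
apply: (@expR_dominated_integrable _ _ _ C) => //.
  by apply: continuous_measurable_fun; exact: continuous_hermite_density.
by move=> z _; exact: hC.
Qed.

(** Complex conjugation makes the density even in [z]. *)
Lemma Re_hermite_half k x : complex.Re (hermite k x) =
  normal_peak 1 * (2 * \int[mu]_(z in `[0, +oo[) hermite_density k x z).
Proof.
have [C hC] := hermite_density_dominated k `|x|.
rewrite Re_hermite (@expR_dominated_even _ _ C)//.
- exact: continuous_hermite_density.
- by move=> z; exact: hC.
- move=> z; rewrite /hermite_density sqrrN; congr (_ * _).
  rewrite (_ : x +i* - z = conjc (x +i* z))// -rmorphXn/=.
  by case: (_ ^+ k).
Qed.

(** The relation He_k' = k He_(k-1), by differentiating [(x + i z) ^ k] under the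
    integral sign *)
Lemma is_derive_Re_hermite k (x : R) :
  is_derive x 1 (fun y => complex.Re (hermite k y))
    (k%:R * complex.Re (hermite k.-1 x)).
Proof.
have -> : (fun y => complex.Re (hermite k y)) =
  (fun y => normal_peak 1 * \int[mu]_(z in [set: R]) hermite_density k y z).
  by apply/funext => y; rewrite Re_hermite.
have [C hC] := hermite_density_dominated k.-1 (`|x| + 1).
have [C' hC'] := hermite_density_dominated k (`|x| + 1).
have xb (y : R) : x - 1 < y < x + 1 -> `|y| <= `|x| + 1.
  by rewrite -ltr_distl => /ltW; have := ler_normD (y - x) x; rewrite subrK; lra.
have := @is_derive_Rintegral R [set: R] (hermite_density k)
  (fun y z => k%:R * hermite_density k.-1 y z) (k%:R * C) x (x - 1) (x + 1) measurableT.
move=> /(_ _)/wrap[].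
  by rewrite ltrBlDr ltrDl ltr01.
move=> /(_ _ _ _)/wrap[].
- move=> y /xb yx; apply: (@expR_dominated_integrable _ _ _ C') => //.
    by apply: continuous_measurable_fun; exact: continuous_hermite_density.
  by move=> z _; exact: hC'.
- move=> y z _ _; rewrite /hermite_density.
  have [hd _] := is_cderiveX k (is_cderive_line y z).
  apply: (is_derive_eq (is_deriveMcst _ hd)).
  rewrite mulr1 -(rmorph_nat (real_complex R)) cReZ; ring.
- move=> y z /xb yx _; rewrite normrM normr_nat -mulrA ler_wpM2l//.
  exact: hC.
move=> h; apply: (is_derive_eq (is_derive_cstM _ h)).
rewrite Re_hermite RintegralZl//; first by ring.
apply: (@expR_dominated_integrable _ _ _ C) => //.
  by apply: continuous_measurable_fun; exact: continuous_hermite_density.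
by move=> z _; apply: hC; rewrite lerDl.
Qed.

End Normal.

(** * Deformation of the contour *)

Section Contour.
Variable R : realType.
Local Notation mu := (@lebesgue_measure R).

(** The entire function whose integral along the line [x + i z], [z] real, gives
    the Hermite polynomial: there [(w - x)^2 / 2 = - z^2 / 2]. *)
Definition hermite_integrand k (x : R) (w : R[i]) : R[i] :=
  w ^+ k * cexp ((2^-1)%:C * (w - x%:C) ^+ 2).

(** The complex derivative of [hermite_integrand], written through the integrand
    itself so that smoothness is inherited *)
Definition dhermite_integrand k (x : R) (w : R[i]) : R[i] :=
  k%:R * hermite_integrand k.-1 x w + (w - x%:C) * hermite_integrand k x w.

Lemma is_cderive_hermite_integrand k x g (t : R) dg : is_cderive g t dg ->
  is_cderive (fun s => hermite_integrand k x (g s)) t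
    (dhermite_integrand k x (g t) * dg).
Proof.
move=> hg; rewrite /hermite_integrand.
have hw : is_cderive (fun s => g s - x%:C) t dg.
  by apply: is_cderive_eq (is_cderiveD hg (is_cderive_cst _ _)) _; rewrite addr0.
apply: is_cderive_eq (is_cderiveM (is_cderiveX k hg)
  (is_cderive_cexp (is_cderiveMl _ (is_cderiveX 2 hw)))) _.
rewrite /dhermite_integrand /hermite_integrand /= expr1.
have h2 : (2^-1)%:C * 2 = 1 :> R[i].
  by rewrite -(rmorph_nat (real_complex R)) -rmorphM/= mulVf ?pnatr_eq0.
have -> : (2^-1)%:C * (2 * (g t - x%:C) * dg) = (g t - x%:C) * dg :> R[i] by rewrite !mulrA h2 mul1r.
move: (cexp _) => c; ring.
Qed.

Lemma cderivable_hermite_integrand k x g : cderivable g ->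
  cderivable (fun s => hermite_integrand k x (g s)).
Proof.
by move=> hg t; have [dg ?] := hg t; eexists; apply: is_cderive_hermite_integrand; eassumption.
Qed.

Lemma cderivable_dhermite_integrand k x g : cderivable g ->
  cderivable (fun s => dhermite_integrand k x (g s)).
Proof.
move=> hg; apply: cderivableD; apply: cderivableM; try exact: cderivable_cst;
  try exact: cderivable_hermite_integrand.
by apply: cderivableD => //; exact: cderivable_cst.
Qed.

Lemma hermite_integrand_real k (x a : R) :
  hermite_integrand k x a%:C = (a ^+ k * expR (2^-1 * (a - x) ^+ 2))%:C.
Proof.
by rewrite rmorphM rmorphXn/= -cexp_real rmorphM rmorphXn rmorphB.
Qed.

(** The ray from [x] in direction i is moved to the ray from [a] in direction [e]
    through the rays from [A t] in direction [E t].  The parameter enters through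
    [S t = sin t ^ 2], which sweeps [0, 1] while being defined and smooth on the
    whole line, so that all bounds hold for every real [t].  The condition
    [0 <= Re e < Im e] keeps [Re (E t ^ 2)] below a negative constant, which is
    what makes the integrand decay along every intermediate ray. *)
Section Homotopy.
Variables (k : nat) (x a : R) (e : R[i]).
Hypotheses (Re_e : 0 <= complex.Re e) (Re_lt_Im : complex.Re e < complex.Im e).

Let S (t : R) : R := sin t ^+ 2.
Let dS (t : R) : R := 2 * sin t * cos t.
Let A (t : R) : R := x + S t * (a - x).
Let E (t : R) : R[i] := 'i + (S t)%:C * (e - 'i).
Let g (t r : R) : R[i] := (A t)%:C + r%:C * E t.
Let dg (t r : R) : R[i] := (dS t)%:C * ((a - x)%:C + r%:C * (e - 'i)).
Let dE (t : R) : R[i] := (dS t)%:C * (e - 'i).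

Let S01 t : 0 <= S t <= 1.
Proof. by rewrite /S sqr_ge0/= -(cos2Dsin2 t) lerDr sqr_ge0. Qed.

Let dS2 t : `|dS t| <= 1.
Proof.
have h := cos2Dsin2 t.
have := sqr_ge0 (cos t - sin t); have := sqr_ge0 (cos t + sin t) => h1 h2.
by rewrite /dS ler_norml; apply/andP; split; nra.
Qed.

Let is_derive_S (t : R) : is_derive t 1 S (dS t).
Proof.
apply: (is_derive_eq (is_deriveX 2 (is_derive_sin t))).
by rewrite /dS expr1.
Qed.

Let is_cderive_E t : is_cderive E t (dE t).
Proof.
apply: is_cderive_eq (is_cderiveD (is_cderive_cst _ _)
  (is_cderiveMr _ (is_cderive_real (is_derive_S t)))) _.
by rewrite add0r.
Qed.

Let is_cderive_gt r t : is_cderive (g ^~ r) t (dg t r).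
Proof.
have hA : is_derive t 1 A (dS t * (a - x)).
  apply: (is_derive_eq (is_deriveD (is_derive_cst x _ _) (is_deriveMcst (a - x) (is_derive_S t)))).
  by rewrite add0r.
apply: is_cderive_eq (is_cderiveD (is_cderive_real hA) (is_cderiveMl r%:C (is_cderive_E t))) _.
by rewrite /dg /dE rmorphM/=; ring.
Qed.

Let is_cderive_gr t r : is_cderive (g t) r (E t).
Proof.
apply: is_cderive_eq (is_cderiveD (is_cderive_cst _ _)
  (is_cderiveMr (E t) (is_cderive_id r))) _.
by rewrite add0r mul1r.
Qed.

Let is_cderive_dgr t r : is_cderive (dg t) r (dE t).
Proof.
apply: is_cderive_eq (is_cderiveMl (dS t)%:C (is_cderiveD (is_cderive_cst (a - x)%:C _)
  (is_cderiveMr (e - 'i) (is_cderive_id r)))) _.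
by rewrite add0r mul1r.
Qed.

Local Notation F := (hermite_integrand k x).
Local Notation F' := (dhermite_integrand k x).

(* Cauchy's theorem in infinitesimal form: [H] is both the t-derivative of
   [F (g t r) * dg/dr] and the r-derivative of [F (g t r) * dg/dt]. *)
Let H t r := F' (g t r) * dg t r * E t + F (g t r) * dE t.

Let is_cderive_Ht r t : is_cderive (fun s => F (g s r) * E s) t (H t r).
Proof.
exact: (is_cderiveM (is_cderive_hermite_integrand k x (is_cderive_gt r t)) (is_cderive_E t)).
Qed.

Let is_cderive_Hr t r : is_cderive (fun s => F (g t s) * dg t s) r (H t r).
Proof.
apply: is_cderive_eq (is_cderiveM (is_cderive_hermite_integrand k x (is_cderive_gr t r))
  (is_cderive_dgr t r)) _.
by rewrite /H; ring.
Qed.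

Let M := 1 + `|x| + `|a - x| + normc (e - 'i).
Let M1 : 1 <= M.
Proof. by have := normr_ge0 x; have := normr_ge0 (a - x); have := normc_ge0 (e - 'i); rewrite /M; lra. Qed.

Let Sle (t y : R) : 0 <= y -> `|S t| * y <= y.
Proof. by have /andP[? ?] := S01 t; rewrite ger0_norm//; nra. Qed.

Let dSle (t y : R) : 0 <= y -> `|dS t| * y <= y.
Proof. by have := dS2 t; nra. Qed.

Let normA t : `|A t| <= M.
Proof.
rewrite (le_trans (ler_normD _ _))// normrM.
have := Sle t (normr_ge0 (a - x)); have := normc_ge0 (e - 'i); rewrite /M; lra.
Qed.

Let normAx t : `|A t - x| <= M.
Proof.
rewrite /A addrAC subrr add0r normrM.
have := Sle t (normr_ge0 (a - x)); have := normc_ge0 (e - 'i).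
by have := normr_ge0 x; rewrite /M; lra.
Qed.

Let normE t : normc (E t) <= M.
Proof.
rewrite (le_trans (normcD _ _))// normcM normc_real.
have := Sle t (normc_ge0 (e - 'i)).
rewrite [normc 'i]/= expr0n/= expr1n add0r sqrtr1.
by have := normr_ge0 x; have := normr_ge0 (a - x); rewrite /M; lra.
Qed.

Let normdE t : normc (dE t) <= M.
Proof.
rewrite normcM normc_real.
have := dSle t (normc_ge0 (e - 'i)).
by have := normr_ge0 x; have := normr_ge0 (a - x); rewrite /M; lra.
Qed.

Let d := Num.min 1 (complex.Im e - complex.Re e).

Let d0 : 0 < d. Proof. by rewrite lt_min ltr01 subr_gt0. Qed.

(* [- Re (E ^ 2)] factors as [(1 - s + s (q - p)) (1 - s + s (q + p))] with
   [e = p + i q], and each factor is at least [d]. *)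
Let Re_sqrE t : complex.Re (E t ^+ 2) <= - d ^+ 2.
Proof.
have /andP[s0 s1] := S01 t.
rewrite expr2 cReM /E !cReD !cImD !cReZ !cImZ !cReB !cImB [complex.Re 'i]/= [complex.Im 'i]/=.
have d1 : d <= 1 by rewrite ge_min lexx.
have d2 : complex.Re e + d <= complex.Im e by rewrite -lerBrDl ge_min lexx orbT.
move: (complex.Re e) (complex.Im e) (S t) Re_e d2 s0 s1 d0 d1 => p q s p0 d2 s0 s1 dp d1.
have f1 : d <= (1 - s + s * (q - p)) by nra.
have f2 : d <= (1 - s + s * (q + p)) by nra.
have := ler_pM (ltW dp) (ltW dp) f1 f2; nra.
Qed.

Let Q (r : R) := M * (1 + r).
Let gauss (r : R) := expR (M ^+ 2 / 2) * expR (M ^+ 2 * r - d ^+ 2 / 2 * r ^+ 2).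

Let Q1 (r : R) : 0 <= r -> 1 <= Q r.
Proof. by move=> r0; rewrite /Q; have := M1; nra. Qed.

Let norm_g (t r : R) : 0 <= r -> normc (g t r) <= Q r.
Proof.
move=> r0; rewrite (le_trans (normcD _ _))// normcM !normc_real (ger0_norm r0) /Q.
by have := normA t; have := normE t; have := M1; nra.
Qed.

Let norm_gx (t r : R) : 0 <= r -> normc (g t r - x%:C) <= Q r.
Proof.
move=> r0; rewrite /g addrAC -rmorphB/=.
rewrite (le_trans (normcD _ _))// normcM !normc_real (ger0_norm r0) /Q.
by have := normAx t; have := normE t; have := M1; nra.
Qed.

Let norm_dg (t r : R) : 0 <= r -> normc (dg t r) <= Q r.
Proof.
move=> r0; rewrite normcM normc_real (le_trans (dSle _ (normc_ge0 _)))//.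
rewrite (le_trans (normcD _ _))// normcM !normc_real (ger0_norm r0) /Q.
have := normr_ge0 x; have := normr_ge0 (a - x); have := normc_ge0 (e - 'i).
by rewrite /M; nra.
Qed.

Let norm_F j (t r : R) : 0 <= r -> normc (hermite_integrand j x (g t r)) <= Q r ^+ j * gauss r.
Proof.
move=> r0; rewrite normcM normcX ler_pM ?exprn_ge0 ?normc_ge0//.
  apply: lerXn2r; rewrite ?nnegrE ?normc_ge0 ?norm_g//.
  by rewrite (le_trans ler01) ?Q1.
rewrite normc_cexp cReZ /gauss -expRD ler_expR /g addrAC -rmorphB/=.
have -> : complex.Re (((A t - x)%:C + r%:C * E t) ^+ 2) =
    (A t - x) ^+ 2 + 2 * (A t - x) * r * complex.Re (E t) + r ^+ 2 * complex.Re (E t ^+ 2).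
  move: (A t - x) (E t) => b p.
  by rewrite !expr2 !cReM !cReD !cImD !cReZ !cImZ !Re_real !Im_real; ring.
have := Re_sqrE t; have := normAx t; have := le_trans (normc_Re _) (normE t).
have := M1.
move: (A t - x) (complex.Re (E t)) (complex.Re (E t ^+ 2)) => b p c.
rewrite !ler_norml => m1 /andP[? ?] /andP[? ?] hc.
have b2 : b ^+ 2 <= M ^+ 2 by nra.
have bp : b * p <= M ^+ 2 by nra.
have bpr : b * p * r <= M ^+ 2 * r by rewrite ler_wpM2r.
have cr : r ^+ 2 * c <= r ^+ 2 * - d ^+ 2 by rewrite ler_wpM2l// sqr_ge0.
by nra.
Qed.

Let norm_F' (t r : R) : 0 <= r -> normc (F' (g t r)) <= (k%:R + 1) * (Q r ^+ k.+1 * gauss r).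
Proof.
move=> r0; rewrite (le_trans (normcD _ _))// [leRHS]mulrDl mul1r lerD//.
  rewrite normcM normc_nat ler_wpM2l// (le_trans (norm_F _ _ _))//.
  rewrite ler_wpM2r ?mulr_ge0 ?expR_ge0// ler_weXn2l ?Q1//.
  by rewrite (leq_trans (leq_pred _)).
rewrite normcM exprS -mulrA ler_pM ?normc_ge0 ?norm_gx//.
exact: norm_F.
Qed.

(* A common majorant for the integrand, the boundary term and the derivative *)
Let B r := (k%:R + 2) * (Q r ^+ k.+3 * gauss r).

Let le_B j (r : R) : (j <= k.+3)%N -> 0 <= r -> Q r ^+ j * gauss r <= B r.
Proof.
move=> jk r0; have g0 : 0 <= gauss r by rewrite mulr_ge0 ?expR_ge0.
have q0 : 0 <= Q r ^+ k.+3 by rewrite exprn_ge0// (le_trans ler01) ?Q1.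
rewrite (@le_trans _ _ (Q r ^+ k.+3 * gauss r))//.
  by rewrite ler_wpM2r// ler_weXn2l ?Q1.
apply: ler_peMl; first by rewrite mulr_ge0.
by have := ler0n R k; lra.
Qed.

Let norm_FE (t r : R) : 0 <= r -> normc (F (g t r) * E t) <= B r.
Proof.
move=> r0; apply: le_trans (@le_B k.+1 _ (leqW (leqnSn _)) r0).
rewrite normcM exprSr mulrAC ler_pM ?normc_ge0 ?norm_F//.
by rewrite (le_trans (normE t))// /Q; have := M1; nra.
Qed.

Let norm_Fdg (t r : R) : 0 <= r -> normc (F (g t r) * dg t r) <= B r.
Proof.
move=> r0; apply: le_trans (@le_B k.+1 _ (leqW (leqnSn _)) r0).
by rewrite normcM exprSr mulrAC ler_pM ?normc_ge0 ?norm_F ?norm_dg.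
Qed.

Let norm_H (t r : R) : 0 <= r -> normc (H t r) <= B r.
Proof.
move=> r0; have g0 : 0 <= gauss r by rewrite mulr_ge0 ?expR_ge0.
have q0 : 0 <= Q r by rewrite (le_trans ler01) ?Q1.
have MQ : M <= Q r by rewrite /Q; have := M1; nra.
rewrite (le_trans (normcD _ _))// /B.
have -> : k%:R + 2 = (k%:R + 1) + 1 :> R by lra.
rewrite [leRHS]mulrDl mul1r lerD//.
  have -> : (k%:R + 1) * (Q r ^+ k.+3 * gauss r) = (k%:R + 1) * (Q r ^+ k.+1 * gauss r) * Q r * Q r.
    by rewrite !exprSr; ring.
  rewrite (normcM (_ * dg t r)) (normcM (F' _)); apply: ler_pM (le_trans (normE t) MQ); rewrite ?mulr_ge0 ?normc_ge0//.
  by apply: ler_pM; rewrite ?normc_ge0 ?norm_F' ?norm_dg.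
rewrite (@le_trans _ _ (Q r ^+ k.+1 * gauss r))//.
  by rewrite normcM exprSr mulrAC ler_pM ?normc_ge0 ?norm_F ?(le_trans (normdE _)).
apply: ler_wpM2r => //; apply: ler_weXn2l; first exact: Q1.
exact: leqW (leqnSn _).
Qed.

Let B_dominated : exists C, forall r, 0 <= r -> B r <= C * expR (- `|r|).
Proof.
have [C [C0 hC]] := poly_gauss_expR_dominated (M ^+ 2) k.+3 (le_trans ler01 M1)
  (divr_gt0 (exprn_gt0 2 d0) (ltr0Sn _ 1)).
exists ((k%:R + 2) * expR (M ^+ 2 / 2) * C) => r r0.
have k0 : 0 <= k%:R + 2 :> R by rewrite addr_ge0.
have := hC r r0; rewrite /B /gauss /Q.
move: (_ ^+ k.+3) (expR (_ - _)) (expR (- _)) (expR (_ / 2)) (expR_ge0 (M ^+ 2 / 2)).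
move=> q g1 g2 c c0 h.
have := ler_wpM2l (mulr_ge0 k0 c0) h; rewrite [X in X <= _ -> _](_ : _ = (k%:R + 2) * (q * (c * g1))); last by ring.
by rewrite !mulrA.
Qed.

Let K t := \int[mu]_(r in `[0, +oo[) complex.Im (F (g t r) * E t).

Let integrable_K t : mu.-integrable `[0, +oo[
  (EFin \o fun r : R => complex.Im (F (g t r) * E t)).
Proof.
have [C hC] := B_dominated.
apply: (@expR_dominated_integrable _ _ _ C) => //.
  apply: measurable_funTS; apply: continuous_measurable_fun.
  apply: (proj2 (cderivable_continuous _)); apply: cderivableM; last exact: cderivable_cst.
  apply: cderivable_hermite_integrand; exact: is_cderive_cderivable (is_cderive_gr t).
move=> r; rewrite /= in_itv/= andbT => r0.
by rewrite (le_trans (normc_Im _))// (le_trans (norm_FE _ _)) ?hC.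
Qed.

(* The integral of [H] in r is the boundary term at the vertex [A t], which is
   real since the vertex moves along the real axis. *)
Let is_derive_K (t : R) : is_derive t 1 K 0.
Proof.
have [C hC] := B_dominated.
have Hc s : continuous (fun r => complex.Im (H s r)).
  apply: (proj2 (cderivable_continuous _)).
  have cg : cderivable (g s) by exact: is_cderive_cderivable (is_cderive_gr s).
  have cdg : cderivable (dg s) by exact: is_cderive_cderivable (is_cderive_dgr s).
  apply: cderivableD; apply: cderivableM; try exact: cderivable_cst.
    by apply: cderivableM => //; exact: cderivable_dhermite_integrand.
  exact: cderivable_hermite_integrand.
have <- : \int[mu]_(r in `[0, +oo[) complex.Im (H t r) = 0.
  have fC r : 0 <= r -> `|complex.Im (H t r)| <= C * expR (- `|r|).
    by move=> r0; rewrite (le_trans (normc_Im _))// (le_trans (norm_H _ _)) ?hC.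
  have FC r : 0 <= r -> `|complex.Im (F (g t r) * dg t r)| <= C * expR (- `|r|).
    by move=> r0; rewrite (le_trans (normc_Im _))// (le_trans (norm_Fdg _ _)) ?hC.
  rewrite (expR_dominated_FTC (fun r => proj2 (is_cderive_Hr t r)) (Hc t) fC FC).
  rewrite /g /dg !mul0r !addr0 -rmorphM cImM Im_real mulr0 add0r Re_real.
  by rewrite hermite_integrand_real Im_real mul0r oppr0.
apply: (@is_derive_Rintegral _ _ _ (fun s r => complex.Im (H s r)) C t (t - 1) (t + 1)) => //.
- by rewrite ltrBlDr ltrDl ltr01.
- by move=> s r _ _; case: (is_cderive_Ht r s).
- move=> s r _; rewrite /= in_itv/= andbT => r0.
  by rewrite (le_trans (normc_Im _))// (le_trans (norm_H _ _)) ?hC.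
Qed.

Let S1 : S (pi / 2) = 1. Proof. by rewrite /S sin_pihalf expr1n. Qed.
Let A1 : A (pi / 2) = a. Proof. by rewrite /A S1 mul1r addrC subrK. Qed.
Let E1 : E (pi / 2) = e. Proof. by rewrite /E S1 mul1r addrC subrK. Qed.

Lemma contour_integrable : mu.-integrable `[0, +oo[ (EFin \o
    fun r : R => complex.Im (hermite_integrand k x (a%:C + r%:C * e) * e)).
Proof. by have := integrable_K (pi / 2); rewrite /g A1 E1. Qed.

(** Only the imaginary part is preserved: the real part of the integral over one
    ray does change with the vertex. *)
Lemma contour_deformation :
  \int[mu]_(r in `[0, +oo[)
     complex.Im (hermite_integrand k x (a%:C + r%:C * e) * e) =
  \int[mu]_(r in `[0, +oo[)
     complex.Im (hermite_integrand k x (x%:C + r%:C * 'i) * 'i).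
Proof.
have := is_derive_0_is_cst (pi / 2) 0 is_derive_K.
have S0 : S 0 = 0 by rewrite /S sin0 expr0n.
have A0 : A 0 = x by rewrite /A S0 mul0r addr0.
have E0 : E 0 = 'i by rewrite /E S0 mul0r addr0.
by rewrite /K /g A1 A0 E1 E0.
Qed.

Lemma Re_hermite_contour : complex.Re (hermite k x) =
  normal_peak 1 * (2 * \int[mu]_(r in `[0, +oo[)
     complex.Im (hermite_integrand k x (a%:C + r%:C * e) * e)).
Proof.
rewrite Re_hermite_half contour_deformation; congr (_ * (_ * _)).
apply: eq_Rintegral => z _.
have -> : x%:C + z%:C * 'i = x +i* z.
  by apply: complex_eq; rewrite ?cReD ?cImD ?cReZ ?cImZ/= ?mulr0 ?addr0 ?add0r ?mulr1.
have -> : hermite_integrand k x (x +i* z) = (expR (- (2^-1 * z ^+ 2)))%:C * (x +i* z) ^+ k.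
  rewrite /hermite_integrand mulrC -cexp_real; congr (cexp _ * _).
  by apply: complex_eq; rewrite ?cReZ ?cImZ expr2 ?cReM ?cImM ?cReB ?cImB ?Re_real ?Im_real/=; ring.
by rewrite cImM cReZ cImZ /hermite_density /=; ring.
Qed.

End Homotopy.
End Contour.

(** * The rescaled integrand *)

Section Omega.
Variable R : realType.

Definition omega : R[i] := 2^-1 +i* (Num.sqrt 3 / 2).

Lemma cos_pi3 : cos (pi / 3) = 2^-1 :> R.
Proof.
have p0 := pi_gt0 R.
have c0 : 0 < cos (pi / 3) :> R by apply: cos_gt0_pihalf; lra.
have : cos (pi / 3 + (pi / 3 + pi / 3)) = -1 :> R by rewrite -cospi; congr cos; lra.
rewrite !cosD !sinD; have := cos2Dsin2 (pi / 3 : R).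
move: c0; move: (cos _) (sin _) => c s c0 h1 h2.
have : (c + 1) * (2 * c - 1) ^+ 2 = 0 by nra.
move=> /eqP; rewrite mulf_eq0 expf_eq0/= => /orP[/eqP|/eqP]; lra.
Qed.

Lemma sin_pi3 : sin (pi / 3) = Num.sqrt 3 / 2 :> R.
Proof.
have p0 := pi_gt0 R.
have s0 : 0 < sin (pi / 3) :> R by apply: sin_gt0_pi; lra.
have h := cos2Dsin2 (pi / 3 : R).
have e3 : 3 = (2 * sin (pi / 3)) ^+ 2 :> R by move: h; rewrite cos_pi3; nra.
have -> : Num.sqrt 3 = 2 * sin (pi / 3) :> R.
  by rewrite [X in Num.sqrt X]e3 sqrtr_sqr ger0_norm// mulr_ge0// ltW.
by field.
Qed.

Lemma cexp_pi3 : cexp (0 +i* (pi / 3)) = omega.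
Proof. by rewrite /cexp /= expR0 mul1r cos_pi3 sin_pi3. Qed.

Lemma Re_omega : complex.Re omega = 2^-1. Proof. by []. Qed.

Lemma normc_omega : normc omega = 1.
Proof. by rewrite -cexp_pi3 normc_cexp expR0. Qed.

Lemma sqr_Im_omega : complex.Im omega ^+ 2 = 3 / 4.
Proof. by have := normc_sqr omega; rewrite normc_omega Re_omega; lra. Qed.

Lemma Re_lt_Im_omega : complex.Re omega < complex.Im omega.
Proof.
have i0 : 0 <= complex.Im omega by rewrite divr_ge0.
by have := sqr_Im_omega; rewrite Re_omega; nra.
Qed.

Lemma Re_omega2 : complex.Re (omega ^+ 2) = - 2^-1.
Proof. by rewrite expr2 cReM -!expr2 Re_omega sqr_Im_omega; lra. Qed.

Lemma omega3 : omega ^+ 3 = -1.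
Proof.
rewrite -cexp_pi3 !exprS mulr1 -!cexpD /cexp !cReD !cImD/= !addr0 expR0.
rewrite (_ : pi / 3 + (pi / 3 + pi / 3) = pi :> R); last by lra.
by rewrite cospi sinpi; apply: complex_eq; rewrite ?cReM ?cImM/=; ring.
Qed.

Lemma normc_le_ReIm (z : R[i]) : normc z <= `|complex.Re z| + `|complex.Im z|.
Proof. by case: z => a b; exact: normc_le_abs. Qed.

Lemma expR_ge1D2 (y : R) : 0 <= y -> 1 + y + y ^+ 2 / 2 <= expR y.
Proof.
move=> y0; rewrite -subr_ge0.
pose f t : R := expR t - (1 + t + t ^+ 2 / 2).
have df (t : R) : is_derive t 1 f (expR t - (1 + t)).
  have h := is_deriveB (is_derive_expR t) (is_deriveD (is_deriveD (is_derive_cst (1 : R) t 1)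
    (is_derive_id t 1)) (is_deriveMcst (2^-1) (is_deriveX 2 (is_derive_id t (1 : R))))).
  apply: (is_derive_eq h); rewrite add0r expr1 /GRing.scale/= mulr1; lra.
have [c] := MVT_segment y0 (fun t _ => df t)
  (continuous_subspaceT (is_derive_continuous df)).
rewrite in_itv/= => /andP[c0 _]; rewrite {2}/f expR0 expr0n/= mul0r !addr0 subrr subr0.
rewrite -/(f y) => ->; rewrite subr0 mulr_ge0// subr_ge0.
exact: expR_ge1Dx.
Qed.

(** [1 + q + q^2] is smaller than exp(q + q^2 / 2) by a cubic term at 0; the cubic
    that may be subtracted in the exponent is the source of the decay of the
    rescaled integrand. *)
Lemma quadratic_le_expR (q : R) : 0 <= q ->
  1 + q + q ^+ 2 <= expR (q + q ^+ 2 / 2 - q ^+ 3 / (8 * (1 + q))).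
Proof.
move=> q0; pose d := q ^+ 3 / (8 * (1 + q)).
have hd : d * (8 * (1 + q)) = q ^+ 3 by rewrite /d mulfVK// gt_eqF// mulr_gt0//; lra.
rewrite -/d; have d0 : 0 <= d by rewrite divr_ge0 ?exprn_ge0//; lra.
have hy : 0 <= q + q ^+ 2 / 2 - d.
  have : d * 8 <= q ^+ 2 by nra.
  nra.
apply: le_trans (expR_ge1D2 hy).
have h : d * (1 + q + q ^+ 2 / 2) <= q ^+ 3 / 2 + q ^+ 4 / 8.
  have : d * (1 + q + q ^+ 2 / 2) <= d * (1 + q) * (4 + q) by nra.
  by move=> /le_trans; apply; rewrite (_ : d * (1 + q) = q ^+ 3 / 8); [nra|lra].
nra.
Qed.
End Omega.

(** Here [eps] stands for n^(-1/3).  With [w = sqrt n (1 + eps r omega)], the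
    function w^n exp((w - x)^2 / 2) equals, up to a factor that does not depend
    on r, [scaled_integrand n r] times exp(- u r omega). *)
Section ScaledIntegrand.
Variables (R : realType) (n : nat) (eps : R).
Hypotheses (eps_gt0 : 0 < eps) (n_eps3 : n%:R * eps ^+ 3 = 1).
Local Notation omega := (omega R).

Definition scaled_base (r : R) : R[i] := 1 + (eps * r)%:C * omega.
Definition scaled_exp (r : R) : R[i] :=
  cexp ((- (n%:R * eps * r))%:C * omega + (n%:R * eps ^+ 2 * r ^+ 2 / 2)%:C * omega ^+ 2).
(** The exponent [j] is [n] for the Hermite polynomial itself and [n.-1] for its
    derivative; the exponential factor is that of degree [n] in both cases. *)
Definition scaled_integrand j (r : R) : R[i] := scaled_base r ^+ j * scaled_exp r.

Local Notation G := (scaled_integrand n).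
Local Notation G' := (scaled_integrand n.-1).

Let n_gt0 : (0 < n)%N.
Proof.
by rewrite lt0n; apply: contra_eq_neq n_eps3 => ->; rewrite mul0r eq_sym oner_neq0.
Qed.

Lemma normc_scaled_base r : normc (scaled_base r) ^+ 2 = 1 + eps * r + (eps * r) ^+ 2.
Proof.
rewrite normc_sqr /scaled_base cReD cImD cReZ cImZ Re_omega Re_real Im_real.
by rewrite add0r exprMn sqr_Im_omega; lra.
Qed.

Lemma scaled_base_ge1 r : 0 <= r -> 1 <= normc (scaled_base r).
Proof.
move=> r0; rewrite -(@ler_pXn2r _ 2)// ?nnegrE ?normc_ge0// expr1n.
rewrite normc_scaled_base -addrA lerDl addr_ge0 ?sqr_ge0 ?mulr_ge0//; exact: ltW.
Qed.

Lemma scaled_integrandE r : G r = scaled_base r * G' r.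
Proof. by rewrite /scaled_integrand mulrA -exprS prednK. Qed.

Lemma normc_scaled_pred_le r : 0 <= r -> normc (G' r) <= normc (G r).
Proof.
move=> r0; rewrite scaled_integrandE normcM ler_peMl ?normc_ge0//.
exact: scaled_base_ge1.
Qed.

(** The square of the modulus is the n-th power of
    [(1 + q + q^2) exp (- q - q^2 / 2)], [q = eps r]. *)
Lemma normc_scaled_le r : 0 <= r ->
  normc (G r) <= expR (- (r ^+ 3 / (16 * (1 + eps * r)))).
Proof.
move=> r0; have q0 : 0 <= eps * r by rewrite mulr_ge0// ltW.
have q1 : 1 + eps * r != 0 by lra.
rewrite -(@ler_pXn2r _ 2)// ?nnegrE ?normc_ge0 ?expR_ge0//.
rewrite normcM normcX exprMn exprAC normc_scaled_base normc_cexp cReD 2!cReZ Re_omega Re_omega2.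
rewrite (@le_trans _ _ (expR (eps * r + (eps * r) ^+ 2 / 2
  - (eps * r) ^+ 3 / (8 * (1 + eps * r))) ^+ n * expR (- (n%:R * eps * r) * 2^-1 +
   n%:R * eps ^+ 2 * r ^+ 2 / 2 * (- 2^-1)) ^+ 2))//.
  rewrite ler_wpM2r ?exprn_ge0 ?expR_ge0//; apply: lerXn2r; rewrite ?nnegrE ?expR_ge0//.
    by rewrite !addr_ge0 ?sqr_ge0.
  exact: quadratic_le_expR.
rewrite -!expRM_natl -expRD ler_expR le_eqVlt; apply/orP; left; apply/eqP.
have -> : r ^+ 3 / (16 * (1 + eps * r)) = n%:R * eps ^+ 3 * (r ^+ 3 / (16 * (1 + eps * r))).
  by rewrite n_eps3 mul1r.
by field.
Qed.

Lemma normc_scaled_le1 r : 0 <= r -> normc (G r) <= 1.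
Proof.
move=> r0; rewrite (le_trans (normc_scaled_le r0))// -expR0 ler_expR oppr_le0.
by rewrite divr_ge0 ?exprn_ge0 ?mulr_ge0 ?addr_ge0 ?mulr_ge0// ltW.
Qed.

(** The majorant uniform in [n] that dominated convergence needs: the cubic decay
    weakens to a quadratic one where [eps r] is not small, so a quadratic one is
    kept everywhere. *)
Lemma normc_scaled_gauss r : eps <= 1 -> 0 <= r ->
  normc (G r) <= expR (- ((r ^+ 2 - r) / 16)).
Proof.
move=> e1 r0; rewrite (le_trans (normc_scaled_le r0))// ler_expR lerN2.
have q0 : 0 <= eps * r by rewrite mulr_ge0// ltW.
rewrite ler_pdivlMr; last by lra.
have qr : eps * r <= r by nra.
have -> : (r ^+ 2 - r) / 16 * (16 * (1 + eps * r)) = (r ^+ 2 - r) * (1 + eps * r) by field.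
move: (eps * r) q0 qr => p p0 pr.
have [r1|r1] := lerP 1 r.
  have rr : 0 <= r ^+ 2 - r by nra.
  rewrite (@le_trans _ _ ((r ^+ 2 - r) * (1 + r)))//; first by rewrite ler_wpM2l// lerD2l.
  by rewrite (_ : (r ^+ 2 - r) * (1 + r) = r ^+ 3 - r); [lra|ring].
rewrite (@le_trans _ _ 0)// ?exprn_ge0// mulr_le0_ge0 ?addr_ge0//; nra.
Qed.

Let is_cderive_base (t : R) : is_cderive scaled_base t (eps%:C * omega).
Proof.
have h : is_derive t 1 (fun r => eps * r) eps.
  by apply: (is_derive_eq (is_derive_cstM _ (is_derive_id t (1:R)))); rewrite mulr1.
apply: is_cderive_eq (is_cderiveD (is_cderive_cst 1 t)
  (is_cderiveMr omega (is_cderive_real h))) _.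
by rewrite add0r.
Qed.

Let is_cderive_exp (t : R) : is_cderive scaled_exp t
  (((- (n%:R * eps))%:C * omega + (n%:R * eps ^+ 2 * t)%:C * omega ^+ 2) * scaled_exp t).
Proof.
have h1 : is_derive t 1 (fun r => - (n%:R * eps * r)) (- (n%:R * eps)).
  apply: (is_derive_eq (is_deriveN (is_derive_cstM _ (is_derive_id t (1:R))))).
  by rewrite mulr1.
have h2 : is_derive t 1 (fun r => n%:R * eps ^+ 2 * r ^+ 2 / 2) (n%:R * eps ^+ 2 * t).
  apply: (is_derive_eq (is_deriveMcst 2^-1 (is_derive_cstM _ (is_deriveX 2 (is_derive_id t (1:R)))))).
  by rewrite expr1 /GRing.scale/=; field.
exact: (is_cderive_cexp (is_cderiveD (is_cderiveMr omega (is_cderive_real h1))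
  (is_cderiveMr (omega ^+ 2) (is_cderive_real h2)))).
Qed.

Lemma cderivable_scaled_integrand j : cderivable (scaled_integrand j).
Proof.
apply: cderivableM; first by apply: cderivableX => t; eexists; exact: is_cderive_base.
by move=> t; eexists; exact: is_cderive_exp.
Qed.

(** The linear and quadratic terms of [n log (1 + eps t omega)] cancel against
    the exponential factor; what remains carries [omega ^ 3 = - 1]. *)
Lemma is_cderive_scaled_integrand (t : R) :
  is_cderive G t (- (t ^+ 2)%:C * G' t).
Proof.
apply: is_cderive_eq (is_cderiveM (is_cderiveX n (is_cderive_base t)) (is_cderive_exp t)) _.
rewrite /scaled_integrand mulrA.
have -> : scaled_base t ^+ n = scaled_base t * scaled_base t ^+ n.-1 by rewrite -exprS prednK.
move: (scaled_base t ^+ n.-1) (scaled_exp t) => b c; rewrite /scaled_base.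
have -> : - (t ^+ 2)%:C = (n%:R * eps ^+ 3 * t ^+ 2)%:C * omega ^+ 3.
  by rewrite omega3 n_eps3 mul1r mulrN1.
move: omega => w; rewrite !(rmorphM, rmorphN, rmorphXn, rmorph_nat)/=.
ring.
Qed.

(** By the previous derivative, the product of the integrand with exp(r^3 / 3) has
    a derivative of size [eps], and it equals 1 at the origin. *)
Lemma scaled_integrand_lim r : 0 <= r ->
  normc (G r - (expR (- (r ^+ 3 / 3)))%:C) <= 2 * (eps * r ^+ 4).
Proof.
move=> r0; pose D t : R[i] := (expR (t ^+ 3 / 3))%:C * G t.
pose dD t : R[i] := (expR (t ^+ 3 / 3))%:C * ((t ^+ 2)%:C * ((eps * t)%:C * omega) * G' t).
have hD (t : R) : is_cderive D t (dD t).
  have h : is_derive t 1 (fun s => s ^+ 3 / 3) (t ^+ 2).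
    apply: (is_derive_eq (is_deriveMcst 3^-1 (is_deriveX 3 (is_derive_id t (1:R))))).
    by rewrite /GRing.scale/=; field.
  apply: is_cderive_eq (is_cderiveM (is_cderive_real
    (is_derive1_comp (is_derive_expR _) h)) (is_cderive_scaled_integrand t)) _.
  by rewrite /dD scaled_integrandE /scaled_base rmorphM; ring.
have bD t : 0 <= t <= r -> normc (dD t) <= expR (r ^+ 3 / 3) * (eps * r ^+ 3).
  move=> /andP[t0 tr]; rewrite /dD.
  have : normc (G' t) <= 1.
    by rewrite (le_trans (normc_scaled_pred_le t0))// normc_scaled_le1.
  move: (G' t) => g g1; rewrite !normcM !normc_real normc_omega mulr1.
  rewrite (ger0_norm (expR_ge0 _)) ger0_norm ?sqr_ge0// ger0_norm ?mulr_ge0 ?(ltW eps_gt0)//.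
  apply: ler_pM; rewrite ?expR_ge0 ?mulr_ge0 ?sqr_ge0 ?normc_ge0 ?(ltW eps_gt0)//.
    by rewrite ler_expR ler_wpM2r// lerXn2r ?nnegrE.
  rewrite -[leRHS]mulr1; apply: ler_pM.
  - by rewrite !mulr_ge0 ?sqr_ge0// ltW.
  - exact: normc_ge0.
  - rewrite mulrCA -exprSr ler_wpM2l ?(ltW eps_gt0)// lerXn2r ?nnegrE//.
  - exact: g1.
have D0 : D 0 = 1.
  rewrite /D /scaled_integrand /scaled_base /scaled_exp !expr0n/= !mulr0 !mul0r oppr0.
  by rewrite expR0 !mul0r !addr0 expr1n cexp0 !mul1r.
have cR := continuous_subspaceT (A:=`[0, r]) (is_derive_continuous (fun t => proj1 (hD t))).
have cI := continuous_subspaceT (A:=`[0, r]) (is_derive_continuous (fun t => proj2 (hD t))).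
have [t] := MVT_segment r0 (fun t _ => proj1 (hD t)) cR.
rewrite in_itv/= => /bD bt; rewrite D0 subr0 => eR.
have [s] := MVT_segment r0 (fun t _ => proj2 (hD t)) cI.
rewrite in_itv/= => /bD bs; rewrite D0 !subr0 => eI.
have -> : G r - (expR (- (r ^+ 3 / 3)))%:C = (expR (- (r ^+ 3 / 3)))%:C * (D r - 1).
  by rewrite mulrBr mulr1 /D mulrA -rmorphM/= -expRD addNr expR0 mul1r.
rewrite normcM normc_real ger0_norm ?expR_ge0// expRN.
rewrite mulrC ler_pdivrMr ?expR_gt0//.
rewrite (le_trans (normc_le_ReIm _))// cReB cImB [complex.Re 1]/= [complex.Im 1]/= subr0.
rewrite eR eI !normrM (ger0_norm r0).
have h1 := ler_wpM2r r0 (le_trans (normc_Re _) bt).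
have h2 := ler_wpM2r r0 (le_trans (normc_Im _) bs).
by rewrite (le_trans (lerD h1 h2))// le_eqVlt; apply/orP; left; apply/eqP; ring.
Qed.

Lemma scaled_integrand_pred_close r : 0 <= r -> normc (G' r - G r) <= eps * r.
Proof.
move=> r0; rewrite scaled_integrandE /scaled_base.
rewrite (_ : _ - _ = - ((eps * r)%:C * omega * G' r)); last by ring.
have : normc (G' r) <= 1.
  by rewrite (le_trans (normc_scaled_pred_le r0))// normc_scaled_le1.
move: (G' r) => g g1; rewrite normcN !normcM normc_omega normc_real mulr1.
by rewrite ger0_norm ?ler_piMr ?mulr_ge0 ?(ltW eps_gt0).
Qed.

End ScaledIntegrand.

(** * The Airy function as an integral over one ray *)

Section Airy.
Variable R : realType.
Local Notation mu := (@lebesgue_measure R).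
Local Notation omega := (omega R).

Lemma itv0y_ge0 (r : R) : `[0, +oo[%classic r -> 0 <= r.
Proof. by rewrite /= in_itv/= andbT. Qed.

(** The factor exp(- u t) of the Airy integrand on the ray [t = r omega] *)
Definition ray_exp (u r : R) : R[i] := cexp ((- (u * r))%:C * omega).

Lemma is_cderive_ray_exp_u (u r : R) :
  is_cderive (ray_exp ^~ r) u (- (r%:C * omega) * ray_exp u r).
Proof.
have h : is_derive u 1 (fun u => - (u * r)) (- r).
  apply: (is_derive_eq (is_deriveN (is_deriveMcst r (is_derive_id u (1:R))))).
  by rewrite mul1r.
apply: is_cderive_eq (is_cderive_cexp (is_cderiveMr omega (is_cderive_real h))) _.
by rewrite rmorphN/= mulNr.
Qed.

Lemma cderivable_ray_exp u : cderivable (ray_exp u).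
Proof.
move=> r.
have h : is_derive r 1 (fun r => - (u * r)) (- u).
  apply: (is_derive_eq (is_deriveN (is_derive_cstM u (is_derive_id r (1:R))))).
  by rewrite mulr1.
by eexists; exact: (is_cderive_cexp (is_cderiveMr omega (is_cderive_real h))).
Qed.

Lemma normc_ray_exp u r : 0 <= r -> normc (ray_exp u r) <= expR (`|u| * r).
Proof.
move=> r0; rewrite normc_cexp cReZ Re_omega ler_expR.
have u1 : - `|u| <= u by rewrite lerNl -normrN ler_norm.
have u0 := normr_ge0 u; nra.
Qed.

Definition airy_integrand (u r : R) : R[i] :=
  (expR (- (r ^+ 3 / 3)))%:C * ray_exp u r.

(** The factor [expR r] leaves room for the multiplier [r omega] that comes with a
    derivative, and the middle one is the majorant of the rescaled integrand. *)
Lemma ray_dominated (U : R) : exists C, 0 <= C /\ forall u r : R, `|u| <= U -> 0 <= r ->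
  expR r * expR (- ((r ^+ 2 - r) / 16)) * expR (`|u| * r) <= C * expR (- `|r|).
Proof.
have d0 : 0 < 16^-1 :> R by rewrite invr_gt0.
have [C [C0 hC]] := poly_gauss_expR_dominated (1 + 16^-1 + U) 0 (@ler01 R) d0.
exists C; split => // u r uU r0; apply: le_trans (hC r r0).
rewrite expr0 mul1r -!expRD ler_expR.
by have : `|u| * r <= U * r; [rewrite ler_wpM2r|lra].
Qed.

Lemma expR_cube_le (r : R) : 0 <= r ->
  expR (- (r ^+ 3 / 3)) <= expR (- ((r ^+ 2 - r) / 16)).
Proof.
move=> r0; rewrite ler_expR lerN2.
have : 0 <= r * (r - 1) ^+ 2 by rewrite mulr_ge0// sqr_ge0.
have : 0 <= r ^+ 2 by rewrite sqr_ge0.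
have : 0 <= r ^+ 3 by rewrite exprn_ge0.
nra.
Qed.

Lemma normc_airy_integrand u r : 0 <= r ->
  normc (airy_integrand u r) <= expR (- ((r ^+ 2 - r) / 16)) * expR (`|u| * r).
Proof.
move=> r0; rewrite normcM normc_real ger0_norm ?expR_ge0// ler_pM ?expR_ge0 ?normc_ge0//.
  exact: expR_cube_le.
exact: normc_ray_exp.
Qed.

Lemma cderivable_airy_integrand u : cderivable (airy_integrand u).
Proof.
apply: cderivableM; last exact: cderivable_ray_exp.
by move=> r; eexists; apply: is_cderive_real.
Qed.

Lemma integrable_airy_integrand u : mu.-integrable `[0, +oo[
  (EFin \o fun r : R => complex.Im (airy_integrand u r * omega)).
Proof.
have [C [C0 hC]] := ray_dominated `|u|.
apply: (@expR_dominated_integrable _ _ _ C) => //.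
  apply: measurable_funTS; apply: continuous_measurable_fun.
  apply: (proj2 (cderivable_continuous _)); apply: cderivableM; last exact: cderivable_cst.
  exact: cderivable_airy_integrand.
move=> r /itv0y_ge0 r0.
rewrite (le_trans (normc_Im _))// normcM normc_omega mulr1.
apply: le_trans (normc_airy_integrand u r0) _; apply: le_trans (hC u r (lexx _) r0).
by rewrite -mulrA ler_peMl ?mulr_ge0 ?expR_ge0// -expR0 ler_expR.
Qed.

(** The two rays of the contour are conjugate, so the difference of their integrals
    is twice the imaginary part of one; on it [t ^ 3 = - r ^ 3]. *)
Lemma airyE u : airy u =
  pi^-1 * \int[mu]_(r in `[0, +oo[) complex.Im (airy_integrand u r * omega).
Proof.
pose F (t : R[i]) := cexp (t ^+ 3 / 3 - u%:C * t).
have FE r : F (r%:C * omega) = airy_integrand u r.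
  have e1 : (r%:C * omega) ^+ 3 / 3 = (- (r ^+ 3 / 3))%:C.
    by rewrite exprMn omega3 mulrN1 mulNr rmorphN/= rmorphM/= rmorphXn/= fmorphV/= rmorph_nat.
  have e2 : - (u%:C * (r%:C * omega)) = (- (u * r))%:C * omega.
    by rewrite rmorphN/= rmorphM/= mulNr mulrA.
  by rewrite /F e1 e2 cexpD cexp_real.
(* Conjugation exchanges the rays. *)
have cM (z w : R[i]) : conjc (z * w) = conjc z * conjc w by rewrite rmorphM.
have cR x : conjc x%:C = x%:C :> R[i] by rewrite /= oppr0.
have Fconj t : F (conjc t) = conjc (F t).
  rewrite /F /cexp; set w := t ^+ 3 / 3 - u%:C * t.
  have -> : (conjc t) ^+ 3 / 3 - u%:C * conjc t = conjc w.
    have -> : w = t * (t * t) * (3^-1)%:C - u%:C * t.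
      by rewrite /w !exprS expr0 mulr1 fmorphV rmorph_nat.
    rewrite [RHS]rmorphB/= !cM !cR; congr (_ - _).
    by rewrite !exprS expr0 mulr1 fmorphV rmorph_nat.
  by case: w => a b /=; rewrite cosN sinN; apply: complex_eq; rewrite ?cReM ?cImM/=; ring.
rewrite /airy /airy_contour -/F /ray_integral.
have -> : cexp (0 +i* (- (pi / 3))) = conjc omega :> R[i].
  by rewrite -cexp_pi3; apply: complex_eq; rewrite /cexp /= cosN sinN expR0; ring.
rewrite cexp_pi3.
set I1 := (X in (X +i* _) - _); set I2 := (X in (_ +i* X) - _).
set I3 := (X in _ - (X +i* _)); set I4 := (X in _ - (_ +i* X)).
have conjray r : F (r%:C * conjc omega) * conjc omega = conjc (F (r%:C * omega) * omega).
  by rewrite cM -Fconj cM cR.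
have e3 : I3 = I1.
  by apply: eq_Rintegral => r _; rewrite conjray; case: (F _ * _).
have e2 : I2 = \int[mu]_(r in `[0, +oo[) complex.Im (airy_integrand u r * omega).
  by apply: eq_Rintegral => r _; rewrite FE.
have e4 : I4 = - I2.
  rewrite e2 -mulN1r -RintegralZl//; last exact: integrable_airy_integrand.
  by apply: eq_Rintegral => r _; rewrite conjray FE mulN1r; case: (_ * omega).
have p0 : pi%:C != 0 :> R[i] by rewrite -(rmorph0 (real_complex R)) (inj_eq (@complexI R)) gt_eqF// pi_gt0.
have i0 : 'i != 0 :> R[i] by rewrite eq_complex /= negb_and oner_neq0 orbT.
have -> : (I1 +i* I2) - (I3 +i* I4) = 2 * I2%:C * 'i.
  rewrite e3 e4; apply: complex_eq; rewrite ?cReB ?cImB ?cReM ?cImM/=; ring.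
have K (p v w : R[i]) : p != 0 -> w != 0 -> (2 * p * w)^-1 * (2 * v * w) = p^-1 * v.
  by move=> ? ?; field; apply/andP.
by rewrite K// mulrC cReZ -fmorphV/= mulrC e2.
Qed.

Lemma is_derive_airy (u : R) : is_derive u 1 (@airy R) (- (pi^-1 *
  \int[mu]_(r in `[0, +oo[) complex.Im (r%:C * omega * airy_integrand u r * omega))).
Proof.
have -> : @airy R = fun u => pi^-1 * \int[mu]_(r in `[0, +oo[) complex.Im (airy_integrand u r * omega).
  by apply/funext => v; exact: airyE.
rewrite -mulrN; apply: is_derive_cstM.
have [C [C0 hC]] := ray_dominated (`|u| + 1).
have ub (v : R) : u - 1 < v < u + 1 -> `|v| <= `|u| + 1.
  by rewrite -ltr_distl => /ltW; have := ler_normD (v - u) u; rewrite subrK; lra.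
pose f' v r : R[i] := r%:C * omega * airy_integrand v r * omega.
have f'C v r : `|v| <= `|u| + 1 -> 0 <= r -> `|complex.Im (f' v r)| <= C * expR (- `|r|).
  move=> vu r0; rewrite (le_trans (normc_Im _))// /f' !(normcM _ omega) normc_omega mulr1.
  rewrite (normcM _ (airy_integrand v r)) (normcM _ omega) normc_omega mulr1 normc_real [X in X * _ <= _](ger0_norm r0).
  apply: le_trans (hC v r vu r0); rewrite -mulrA; apply: ler_pM => //.
  - exact: normc_ge0.
  - by rewrite (le_trans _ (expR_ge1Dx _))// lerDr.
  - exact: normc_airy_integrand.
have cf' v : cderivable (f' v).
  apply: cderivableM; last exact: cderivable_cst.
  apply: cderivableM; last exact: cderivable_airy_integrand.
  by apply: cderivableM; [exact: cderivable_id|exact: cderivable_cst].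
have -> : - (\int[mu]_(r in `[0, +oo[) complex.Im (f' u r)) =
    \int[mu]_(r in `[0, +oo[) (- complex.Im (f' u r)).
  rewrite -mulN1r -RintegralZl//.
    by apply: eq_Rintegral => r _; rewrite mulN1r.
  apply: (@expR_dominated_integrable _ _ _ C) => //.
    apply: measurable_funTS; apply: continuous_measurable_fun.
    exact: (proj2 (cderivable_continuous (cf' u))).
  by move=> r /itv0y_ge0 r0; apply: f'C => //; rewrite lerDl.
apply: (@is_derive_Rintegral _ _ _ (fun v r => - complex.Im (f' v r)) C u (u - 1) (u + 1)) => //.
- by rewrite ltrBlDr ltrDl ltr01.
- by move=> v _; exact: integrable_airy_integrand.
- move=> v r _ _; rewrite -cImN.
  have h := is_cderiveMr omega (is_cderiveMl (expR (- (r ^+ 3 / 3)))%:C (is_cderive_ray_exp_u v r)).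
  by case: (is_cderive_eq h (_ : _ = - f' v r)) => //; rewrite /f' /airy_integrand; ring.
- by move=> v r /ub vu /itv0y_ge0 r0; rewrite normrN; exact: f'C.
Qed.

(** Dominated convergence along the ray, for integrands that carry a multiplier:
    1 for the Airy function, [r omega] for its derivative. *)
Lemma ray_integral_cvg (u C0 : R) (h_ : nat -> R -> R[i]) (h : R -> R[i]) :
  (forall n, cderivable (h_ n)) ->
  (forall n r, 0 <= r -> normc (h_ n r) <= C0 * expR r * expR (- ((r ^+ 2 - r) / 16))) ->
  (forall r, 0 <= r -> normc (h_ n r - h r) @[n --> \oo] --> 0) ->
  \int[mu]_(r in `[0, +oo[) complex.Im (h_ n r * ray_exp u r * omega) @[n --> \oo] -->
  \int[mu]_(r in `[0, +oo[) complex.Im (h r * ray_exp u r * omega).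
Proof.
move=> ch hb hcvg; have [C [Cge0 hC]] := ray_dominated `|u|.
have normI z r : `|complex.Im (z * ray_exp u r * omega)| <= normc z * normc (ray_exp u r).
  by rewrite (le_trans (normc_Im _))// !normcM normc_omega mulr1.
apply: (@expR_dominated_cvg _ _ _ _ (C0 * C)) => //.
- move=> n; apply: measurable_funTS; apply: continuous_measurable_fun.
  apply: (proj2 (cderivable_continuous _)); apply: cderivableM; last exact: cderivable_cst.
  by apply: cderivableM => //; exact: cderivable_ray_exp.
- move=> n r /itv0y_ge0 r0; rewrite (le_trans (normI _ _))//.
  have b := ler_pM (normc_ge0 _) (normc_ge0 _) (hb n r r0) (normc_ray_exp u r0).
  apply: le_trans b _; rewrite -!mulrA.
  have C00 : 0 <= C0.
    have := le_trans (normc_ge0 _) (hb 0%N 0 (lexx 0)).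
    by rewrite -mulrA pmulr_lge0// mulr_gt0 ?expR_gt0.
  by rewrite ler_wpM2l// mulrA hC.
- move=> r /itv0y_ge0 r0.
  apply/subr_cvg0; apply: norm_cvg0.
  have l0 : normc (h_ n r - h r) * normc (ray_exp u r) @[n --> \oo] --> 0.
    rewrite -(mul0r (normc (ray_exp u r))); apply: cvgM; first exact: hcvg.
    exact: cvg_cst.
  apply: (@squeeze_cvgr _ _ _ _ (cst 0)
    (fun n => normc (h_ n r - h r) * normc (ray_exp u r))); [|exact: cvg_cst|exact: l0].
  apply: nearW => n; rewrite normr_ge0/=.
  by rewrite -cImB -!mulrBl; exact: normI.
Qed.

End Airy.

(** * Stirling's formula *)

Section Stirling.
Variable R : realType.
Local Notation mu := (@lebesgue_measure R).

Lemma is_deriveX_fun (f : R -> R) m (t df : R) :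
  is_derive t 1 f df -> is_derive t 1 (fun s => f s ^+ m) (m%:R * f t ^+ m.-1 * df).
Proof.
move=> hf; rewrite (_ : (fun s => _) = f ^+ m); first exact: is_deriveX.
by apply/funext => s; rewrite exprfctE.
Qed.

Section Moments.
Variable c : R.
Hypothesis c_ge0 : 0 <= c.

Let P m (s : R) : R := (c + s) ^+ m * expR (- (c + s) ^+ 2).

Let is_derive_P m (s : R) :
  is_derive s 1 (P m) (m%:R * P m.-1 s - 2 * P m.+1 s).
Proof.
have h1 : is_derive s 1 (fun s => c + s) 1.
  by apply: (is_derive_eq (is_deriveD (is_derive_cst c s 1) (is_derive_id s (1:R)))); rewrite add0r.
have h2 := is_derive1_comp (is_derive_expR _) (is_deriveN (is_deriveX 2 h1)).
apply: (is_derive_eq (is_deriveM_fun (is_deriveX_fun m h1) h2)).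
rewrite /P /GRing.scale/= [in RHS](exprS _ m) expr1.
ring.
Qed.

Let P_dominated m : exists C : R, forall s : R, - c <= s -> `|P m s| <= C * expR (- `|s|).
Proof.
have [C [C0 hC]] := poly_gauss_expR_dominated 0 m (@ler01 R) (@ltr01 R).
exists (C * expR c) => s cs; have t0 : 0 <= c + s by rewrite -lerBlDl sub0r.
rewrite ger0_norm ?mulr_ge0 ?exprn_ge0 ?expR_ge0//.
apply: (@le_trans _ _ (C * expR (- `|c + s|))).
  apply: le_trans (hC _ t0); rewrite mul1r mul0r sub0r mul1r.
  rewrite ler_wpM2r ?expR_ge0//.
  by apply: lerXn2r; rewrite ?nnegrE ?lerDr ?(addr_ge0 ler01).
rewrite -mulrA ler_wpM2l// -expRD ler_expR (ger0_norm t0).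
have c0 := c_ge0; have : `|s| <= (c + s) + c by rewrite ler_norml; apply/andP; split; lra.
lra.
Qed.

Let continuous_P m : continuous (P m).
Proof. exact: is_derive_continuous (is_derive_P m). Qed.

Let integrable_P m : mu.-integrable `[- c, +oo[ (EFin \o P m).
Proof.
have [C hC] := P_dominated m.
apply: (@expR_dominated_integrable _ _ _ C) => //.
  by apply: measurable_funTS; apply: continuous_measurable_fun.
by move=> s; rewrite /= in_itv/= andbT; exact: hC.
Qed.

Let FTC_P m : m%:R * \int[mu]_(s in `[- c, +oo[) P m.-1 s
    - 2 * \int[mu]_(s in `[- c, +oo[) P m.+1 s = - P m (- c).
Proof.
have [C hC] := P_dominated m; have [C1 hC1] := P_dominated m.-1.
have [C2 hC2] := P_dominated m.+1.
have i1 := integrable_P m.-1; have i2 := integrable_P m.+1.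
pose K := `|C| + m%:R * C1 + 2 * C2.
have KC (s : R) : - c <= s -> `|m%:R * P m.-1 s - 2 * P m.+1 s| <= K * expR (- `|s|).
  move=> cs; rewrite (le_trans (ler_normB _ _))// (normrM m%:R) (normrM 2) !normr_nat /K.
  have a1 := ler_wpM2l (ler0n R m) (hC1 s cs); have a2 := hC2 s cs.
  have a0 : 0 <= `|C| * expR (- `|s|) by rewrite mulr_ge0 ?expR_ge0.
  by move: (expR _) (`|P _ _|) (`|P _ _|) a0 a1 a2 => E p1 p2 *; lra.
have PK (s : R) : - c <= s -> `|P m s| <= K * expR (- `|s|).
  move=> cs; apply: le_trans (hC s cs) _; rewrite ler_wpM2r ?expR_ge0// /K.
  have C1g : 0 <= C1.
    by have := le_trans (normr_ge0 _) (hC1 s cs); rewrite pmulr_lge0// expR_gt0.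
  have C2g : 0 <= C2.
    by have := le_trans (normr_ge0 _) (hC2 s cs); rewrite pmulr_lge0// expR_gt0.
  have := ler_norm C; have : 0 <= m%:R * C1 by rewrite mulr_ge0.
  lra.
have cont : continuous (fun s => m%:R * P m.-1 s - 2 * P m.+1 s).
  move=> s; apply: cvgB; apply: cvgM; try exact: cvg_cst; exact: continuous_P.
rewrite -(expR_dominated_FTC (is_derive_P m) cont KC PK).
rewrite RintegralB//; last 2 first.
- exact: (integrableZl _ m%:R i1).
- exact: (integrableZl _ 2 i2).
by rewrite !RintegralZl.
Qed.

(** The substitution [t = c + s] in k! = 2 int_0^oo t^(2k+1) exp(- t^2) dt, for an
    arbitrary shift [c]; with [c = sqrt k] the maximum is centred at [s = 0].
    Integrating the derivative of [P (2k+2)] gives the recurrence in [k]. *)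
Lemma factorial_moment k :
  \int[mu]_(s in `[- c, +oo[) P (k.*2.+1) s = k`!%:R / 2.
Proof.
elim: k => [|k IH].
  have := FTC_P 0; rewrite mul0r sub0r /P subrr expr0 mul1r expr0n/= oppr0 expR0.
  move=> /eqP; rewrite eqr_opp => /eqP h.
  by apply: (@mulfI _ 2) => //; rewrite [LHS]h fact0; field.
have := FTC_P (k.*2.+2); rewrite -/(P _ _) /= IH /P subrr expr0n mul0r oppr0 => /eqP.
rewrite subr_eq0 => /eqP h.
rewrite doubleS; apply: (@mulfI _ 2) => //.
by rewrite -h factS natrM -addn2 natrD -muln2 natrM -(natr1 k); field.
Qed.
End Moments.

Lemma ln1D_bound (y : R) : `|y| <= 2^-1 ->
  `|ln (1 + y) - (y - y ^+ 2 / 2)| <= 2 * `|y| ^+ 3.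
Proof.
move=> y2; pose f t : R := ln (1 + t) - (t - t ^+ 2 / 2).
have df (t : R) : `|t| <= `|y| -> is_derive t 1 f (t ^+ 2 / (1 + t)).
  move=> ty; have t1 : 0 < 1 + t.
    by have := le_trans ty y2; rewrite ler_norml => /andP[? ?]; lra.
  have h1 : is_derive t 1 (fun s => 1 + s) 1.
    by apply: (is_derive_eq (is_deriveD (is_derive_cst (1:R) t 1) (is_derive_id t (1:R)))); rewrite add0r.
  have h := is_deriveB (is_derive1_comp (is_derive1_ln t1) h1)
    (is_deriveB (is_derive_id t (1:R)) (is_deriveMcst 2^-1 (is_deriveX 2 (is_derive_id t (1 : R))))).
  apply: (is_derive_eq h); rewrite expr1 /GRing.scale/= !mulr1; field.
  by rewrite gt_eqF.
have f0 : f 0 = 0 by rewrite /f addr0 ln1 expr0n/= mul0r !subr0.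
have bd (t : R) : `|t| <= `|y| -> `|t ^+ 2 / (1 + t)| <= 2 * `|y| ^+ 2.
  move=> ty; have t1 : 2^-1 <= 1 + t.
    by have := le_trans ty y2; rewrite ler_norml => /andP[? ?]; lra.
  have t2 : `|t| ^+ 2 <= `|y| ^+ 2 by rewrite lerXn2r ?nnegrE.
  have tp : 0 < 1 + t by lra.
  rewrite normrM normfV (ger0_norm (ltW tp)) normrX ler_pdivrMr//.
  have := sqr_ge0 `|y|; nra.
rewrite -/(f y).
have [y0|y0] := leP 0 y.
- have dfi t : t \in `]0, y[ -> is_derive t 1 f (t ^+ 2 / (1 + t)).
    by rewrite in_itv/= => /andP[t0 ty]; apply: df; rewrite (ger0_norm (ltW t0)) (ger0_norm y0) ltW.
  have cf : {within `[0, y], continuous f}.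
    apply: derivable_within_continuous => t; rewrite in_itv/= => /andP[t0 ty].
    by have [] := df t; rewrite // (ger0_norm t0) (ger0_norm y0).
  have [t] := MVT_segment y0 dfi cf.
  rewrite in_itv/= f0 !subr0 => /andP[t0 ty] ->.
  by rewrite normrM (exprSr `|y|) mulrA ler_wpM2r// bd// (ger0_norm t0) (ger0_norm y0).
- have dfi t : t \in `]y, 0[ -> is_derive t 1 f (t ^+ 2 / (1 + t)).
    by rewrite in_itv/= => /andP[t0 ty]; apply: df; rewrite (ltr0_norm ty) (ltr0_norm y0) lerN2 ltW.
  have cf : {within `[y, 0], continuous f}.
    apply: derivable_within_continuous => t; rewrite in_itv/= => /andP[t0 ty].
    by have [] := df t; rewrite // (ler0_norm ty) (ltr0_norm y0) lerN2.
  have [t] := MVT_segment (ltW y0) dfi cf.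
  rewrite in_itv/= f0 !sub0r => /andP[t0 ty] h.
  rewrite -normrN h normrM normrN (exprSr `|y|) mulrA ler_wpM2r// bd//.
  by rewrite (ler0_norm ty) (ltr0_norm y0) lerN2.
Qed.

Lemma cvg_inv_sqrt : (Num.sqrt (j.+1%:R : R))^-1 @[j --> \oo] --> (0 : R).
Proof.
rewrite (_ : (fun j => _) = (fun j => Num.sqrt (harmonic j))); last first.
  by apply/funext => j; rewrite /harmonic/= sqrtrV.
rewrite -[X in _ --> X]sqrtr0.
by apply: continuous_cvg; [exact: sqrt_continuous|exact: cvg_harmonic].
Qed.

(** The total mass of the normal law of standard deviation 1/2 *)
Lemma integral_gauss2 : \int[mu]_(s in [set: R]) expR (- (2 * s ^+ 2)) = Num.sqrt (pi / 2).
Proof.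
have h2 : 2^-1 != 0 :> R by rewrite invr_neq0.
have := integral_normal_pdf (0 : R) 2^-1.
under eq_integral do rewrite normal_pdfE//.
rewrite -/(Rintegral _ _ _) => h.
have pE : normal_peak (2^-1 : R) = (Num.sqrt (pi / 2))^-1.
  by rewrite /normal_peak; congr (Num.sqrt _)^-1; rewrite -mulr_natl; field.
have q0 : Num.sqrt (pi / 2) != 0 :> R.
  by rewrite gt_eqF// sqrtr_gt0 divr_gt0 ?pi_gt0.
pose g (s : R) := expR (- (2 * s ^+ 2)).
have gE s : normal_fun 0 2^-1 s = g s.
  rewrite /normal_fun /g subr0; congr expR; rewrite -mulr_natl; by field.
have cg : continuous g.
  move=> s; apply: continuous_comp; last exact: continuous_expR.
  by apply: cvgN; apply: cvgM; [exact: cvg_cst|exact: sqr_continuous].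
have [C [C0 hC]] := poly_gauss_expR_dominated 0 0 (@ler01 R) (@ltr0Sn R 1).
have gi : mu.-integrable [set: R] (EFin \o g).
  apply: (@expR_dominated_integrable _ _ _ C) => //; first exact: continuous_measurable_fun.
  move=> s _; have := hC `|s| (normr_ge0 s).
  rewrite expr0 mul1r mul0r sub0r normr_id real_normK ?num_real//.
  by rewrite /g (ger0_norm (expR_ge0 _)).
have : \int[mu]_(s in [set: R]) ((Num.sqrt (pi / 2))^-1 * g s) = 1.
  rewrite /Rintegral -[RHS]/(fine 1%E) -h; congr fine.
  by apply: eq_integral => s _; rewrite pE gE.
rewrite RintegralZl// => /(congr1 ( *%R (Num.sqrt (pi / 2)))).
by rewrite mulVKf// mulr1.
Qed.

(* [W j] is the integrand of [factorial_moment] at [k = j.+1], [c = sqrt k],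
   divided by its value at [s = 0]. *)
Let c j : R := Num.sqrt j.+1%:R.
Let W j (s : R) : R := (1 + s / c j) ^+ (j.+1).*2.+1 * expR (- (2 * c j * s + s ^+ 2)).

Let c_ge1 j : 1 <= c j.
Proof. by rewrite -[leLHS]sqrtr1 ler_wsqrtr// ler1n. Qed.

Let c_gt0 j : 0 < c j. Proof. exact: lt_le_trans ltr01 (c_ge1 j). Qed.

Let c_sqr j : c j ^+ 2 = j.+1%:R. Proof. by rewrite sqr_sqrtr. Qed.

Let W_ge0 j (s : R) : - c j <= s -> 0 <= 1 + s / c j.
Proof.
move=> cs; have c0 := c_gt0 j.
by rewrite -lerBlDl sub0r ler_pdivlMr// mulN1r.
Qed.

(* From [1 + y <= exp y] alone: the factor [(1 + s / c) ^ (2 k)] is at most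
   [exp (2 c s)], so that only [1 + s / c] and [exp (- s^2)] are left. *)
Let W_le j (s : R) : - c j <= s -> `|W j s| <= (1 + `|s|) * expR (- s ^+ 2).
Proof.
move=> cs; have y0 := W_ge0 cs; have c0 := c_gt0 j.
have W0 : 0 <= W j s by rewrite mulr_ge0 ?exprn_ge0 ?expR_ge0.
rewrite (ger0_norm W0) /W opprD expRD mulrA ler_wpM2r ?expR_ge0//.
rewrite exprS -mulrA -[leRHS]mulr1; apply: ler_pM => //.
- by rewrite mulr_ge0 ?exprn_ge0 ?expR_ge0.
- rewrite lerD2l (le_trans (ler_norm _))// normrM normfV (gtr0_norm c0).
  by rewrite ler_piMr// invf_le1.
- rewrite (@le_trans _ _ (expR (s / c j) ^+ (j.+1).*2 * expR (- (2 * c j * s))))//.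
    rewrite ler_wpM2r ?expR_ge0//; apply: lerXn2r; rewrite ?nnegrE ?expR_ge0//.
    exact: expR_ge1Dx.
  rewrite -expRM_natl -expRD -muln2 natrM -(c_sqr j).
  rewrite (_ : _ + _ = 0) ?expR0//; field; exact: lt0r_neq0.
Qed.

Let continuous_W j : continuous (W j).
Proof.
have h1 (s : R) : is_derive s 1 (fun s => 1 + s / c j) (c j)^-1.
  apply: (is_derive_eq (is_deriveD (is_derive_cst (1 : R) s 1) (is_deriveMcst (c j)^-1 (is_derive_id s (1:R))))).
  by rewrite add0r mul1r.
have h2 (s : R) : is_derive s 1 (fun s => - (2 * c j * s + s ^+ 2)) (- (2 * c j + 2 * s)).
  apply: (is_derive_eq (is_deriveN (is_deriveD (is_derive_cstM (2 * c j) (is_derive_id s (1:R))) (is_deriveX 2 (is_derive_id s (1:R)))))).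
  by rewrite mulr1 expr1 /GRing.scale/= mulr1.
apply: is_derive_continuous => s.
exact: (is_deriveM_fun (is_deriveX_fun _ (h1 s)) (is_derive1_comp (is_derive_expR _) (h2 s))).
Qed.

Let measurable_W j : measurable_fun [set: R] (W j).
Proof. by apply: continuous_measurable_fun; exact: continuous_W. Qed.

Let W_dominated : exists C : R, 0 <= C /\ forall j (s : R), - c j <= s -> `|W j s| <= C * expR (- `|s|).
Proof.
have [C [C0 hC]] := poly_gauss_expR_dominated 0 1 (@ler01 R) (@ltr01 R).
exists C; split => // j s cs; apply: le_trans (W_le cs) _.
have := hC `|s| (normr_ge0 s).
by rewrite expr1 mul1r mul0r sub0r mul1r normr_id real_normK ?num_real.
Qed.

Let W_integrable j : mu.-integrable `[- c j, +oo[ (EFin \o W j).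
Proof.
have [C [C0 hC]] := W_dominated.
apply: (@expR_dominated_integrable _ _ _ C) => //; first exact: measurable_funTS.
by move=> s; rewrite /= in_itv/= andbT; exact: hC.
Qed.

Let W_int j : \int[mu]_(s in [set: R]) (W j \_ `[- c j, +oo[) s =
  (j.+1)`!%:R / 2 / (c j ^+ (j.+1).*2.+1 * expR (- j.+1%:R)).
Proof.
have c0 := c_gt0 j.
have d0 : c j ^+ (j.+1).*2.+1 * expR (- j.+1%:R) != 0.
  by rewrite gt_eqF// mulr_gt0 ?exprn_gt0 ?expR_gt0.
rewrite -Rintegral_mkcond -(factorial_moment (ltW c0)).
apply: (mulIf d0); rewrite divfK// -(RintegralZr _ _ (W_integrable j))//.
apply: eq_Rintegral => s _; rewrite /W.
have -> : expR (- (c j + s) ^+ 2) = expR (- (2 * c j * s + s ^+ 2)) * expR (- j.+1%:R).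
  by rewrite -expRD -(c_sqr j); congr expR; ring.
have -> : c j + s = (1 + s / c j) * c j by field; exact: lt0r_neq0.
by rewrite exprMn; ring.
Qed.

(* [ln (1 + y) = y - y^2 / 2 + O(y^3)] turns the power into another [exp (- s^2)]. *)
Let W_cvg (s : R) : (W j \_ `[- c j, +oo[) s @[j --> \oo] --> expR (- (2 * s ^+ 2)).
Proof.
have cV := cvg_inv_sqrt.
pose y j := s / c j.
have y0 : y j @[j --> \oo] --> (0 : R).
  by rewrite -(mulr0 s); apply: cvgM => //; exact: cvg_cst.
pose d j : R := 2 * j.+1%:R * (ln (1 + y j) - (y j - y j ^+ 2 / 2)).
have y2 : \forall j \near \oo, `|y j| < 2^-1.
  by apply: (@cvgr0_norm_lt _ _ _ _ _ _ y0); rewrite invr_gt0.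
have d0 : d j @[j --> \oo] --> (0 : R).
  apply: norm_cvg0.
  have l0 : (4 * `|s| ^+ 3) * (c j)^-1 @[j --> \oo] --> (0 : R).
    by rewrite -(mulr0 (4 * `|s| ^+ 3)); apply: cvgM => //; exact: cvg_cst.
  apply: (@squeeze_cvgr _ _ _ _ (cst 0) (fun j => (4 * `|s| ^+ 3) * (c j)^-1));
    [|exact: cvg_cst|exact: l0].
  near=> j; rewrite normr_ge0/= /d normrM ger0_norm ?mulr_ge0//.
  have yj : `|y j| <= 2^-1 by apply: ltW; near: j; exact: y2.
  have p0 : 0 <= 2 * j.+1%:R :> R by rewrite mulr_ge0.
  apply: le_trans (ler_wpM2l p0 (ln1D_bound yj)) _.
  rewrite /y normrM normfV (ger0_norm (ltW (c_gt0 j))) -(c_sqr j) le_eqVlt.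
  by apply/orP; left; apply/eqP; field; exact: lt0r_neq0.
have e0 : (1 + y j) * (expR (- (2 * s ^+ 2)) * expR (d j)) @[j --> \oo] -->
    (1 + 0) * (expR (- (2 * s ^+ 2)) * expR 0).
  apply: cvgM; first by apply: cvgD => //; exact: cvg_cst.
  apply: cvgM; first exact: cvg_cst.
  by apply: continuous_cvg => //; exact: continuous_expR.
move: e0; rewrite expR0 mulr1 addr0 mul1r; apply: cvg_trans; apply: near_eq_cvg.
near=> j.
have yj : `|y j| < 2^-1 by near: j; exact: y2.
have y1 : 0 < 1 + y j by move: yj; rewrite ltr_norml => /andP[? ?]; lra.
rewrite patchE ifT; last first.
  rewrite inE/= in_itv/= andbT.
  have := mulr_gt0 y1 (c_gt0 j); rewrite mulrDl mul1r divfK ?lt0r_neq0//; lra.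
have e1 : (1 + y j) ^+ (j.+1).*2.+1 = (1 + y j) * expR ((j.+1).*2%:R * ln (1 + y j)).
  by rewrite exprS expRM_natl lnK ?posrE.
rewrite /W -/(y j) e1 -[RHS]mulrA; congr (_ * _).
rewrite -!expRD; congr expR.
rewrite /d -muln2 natrM.
have -> : s = y j * c j by rewrite /y divfK// lt0r_neq0.
by rewrite -(c_sqr j); field.
Unshelve. all: end_near. Qed.

(** Laplace's method for the shifted moment, whose peak has a width that does not
    depend on the degree: the integrands converge as they stand. *)
Theorem stirling :
  (j.+1)`!%:R / (Num.sqrt j.+1%:R ^+ (j.+1).*2.+1 * expR (- j.+1%:R)) @[j --> \oo]
    --> (Num.sqrt (2 * pi) : R).
Proof.
have [C [C0 hC]] := W_dominated.
have h : \int[mu]_(s in [set: R]) (W j \_ `[- c j, +oo[) s @[j --> \oo] -->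
    \int[mu]_(s in [set: R]) expR (- (2 * s ^+ 2)).
  apply: (@expR_dominated_cvg _ _ _ _ C) => //.
  - move=> j; apply/(measurable_restrictT _ _).1 => //.
    exact: measurable_funTS.
  - move=> j s _; rewrite patchE; case: ifPn => [|_]; last by rewrite normr0 mulr_ge0 ?expR_ge0.
    by rewrite inE/= in_itv/= andbT; exact: hC.
rewrite integral_gauss2 in h.
rewrite (_ : (fun j => _) = fun j => 2 * \int[mu]_(s in [set: R]) (W j \_ `[- c j, +oo[) s); last first.
  by apply/funext => j; rewrite W_int -mulrA mulrCA -!mulrA; congr (_ * _); rewrite mulVKf.
have -> : Num.sqrt (2 * pi) = 2 * Num.sqrt (pi / 2) :> R.
  have e2 : 2 = Num.sqrt (2 ^+ 2) :> R by rewrite sqrtr_sqr ger0_norm.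
  rewrite [X in _ = X * _]e2 -sqrtrM ?sqr_ge0//.
  congr Num.sqrt; by field.
by apply: cvgM => //; exact: cvg_cst.
Qed.

End Stirling.

(** * Rescaling at the turning point *)

Section Scaling.
Variable R : realType.
Local Notation mu := (@lebesgue_measure R).
Local Notation omega := (omega R).

(** Splitting the exponent by powers of [omega] reduces its comparison with the
    rescaled one to three identities between real numbers. *)
Lemma half_sqr_affine (a b : R) (w : R[i]) :
  (2^-1)%:C * (a%:C + b%:C * w) ^+ 2 =
    (a ^+ 2 / 2)%:C + ((a * b)%:C * w + (b ^+ 2 / 2)%:C * w ^+ 2).
Proof.
have h2 : (2^-1)%:C * 2 = 1 :> R[i].
  by rewrite -(rmorph_nat (real_complex R)) -rmorphM/= mulVf ?pnatr_eq0.
rewrite !rmorphM/=; move: (2^-1)%:C h2 (a%:C) (b%:C) => h h2 A B.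
by rewrite -[A * B * w]mul1r -h2; ring.
Qed.

(** [kappa] is n^(1/6); it is kept as a free variable tied to [n] by [kappa6] so that
    the identities below are rational in [kappa]. *)
Section FixedDegree.
Variables (n : nat) (kappa u : R).
Hypotheses (kappa_gt0 : 0 < kappa) (kappa6 : kappa ^+ 6 = n%:R).

Let eps := (kappa ^+ 2)^-1.
Let x := 2 * kappa ^+ 3 + kappa^-1 * u.
Let k0 : kappa != 0. Proof. exact: lt0r_neq0. Qed.

Definition scaled_moment i := \int[mu]_(r in `[0, +oo[)
  complex.Im (scaled_integrand n eps i r * ray_exp u r * omega).

Let c i := kappa ^+ (3 * i).+1 * expR (- (n%:R / 2) + u ^+ 2 / (4 * kappa ^+ 2)).

(** The change of variable [w = kappa^3 + kappa r omega] at
    [x = 2 kappa^3 + u / kappa]; the vertex [kappa^3 = sqrt n] is the double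
    critical point of the exponent. *)
Lemma hermite_integrand_scaled i r :
  hermite_integrand i x ((kappa ^+ 3)%:C + r%:C * (kappa%:C * omega)) * (kappa%:C * omega) =
  (c i / expR (- (x ^+ 2 / 4)))%:C * (scaled_integrand n eps i r * ray_exp u r * omega).
Proof.
have -> : (kappa ^+ 3)%:C + r%:C * (kappa%:C * omega) = (kappa ^+ 3)%:C * scaled_base eps r.
  have -> : scaled_base eps r = 1 + (eps * r)%:C * omega by [].
  rewrite mulrDr mulr1; congr (_ + _); rewrite !mulrA -!rmorphM/=; congr (_%:C * _).
  by rewrite /eps; field.
pose a := - (kappa ^+ 3 + kappa^-1 * u); pose b := kappa * r.
have wx : (kappa ^+ 3)%:C * scaled_base eps r - x%:C = a%:C + b%:C * omega.
  have -> : scaled_base eps r = 1 + (eps * r)%:C * omega by [].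
  rewrite mulrDr mulr1 mulrA -rmorphM/= addrAC -rmorphB/=.
  by congr (_%:C + _%:C * _); rewrite /a /b /x /eps; [ring|field].
rewrite /hermite_integrand wx exprMn -rmorphXn/= -exprM.
rewrite half_sqr_affine.
have e1 : a ^+ 2 / 2 = (- (n%:R / 2) + u ^+ 2 / (4 * kappa ^+ 2)) + x ^+ 2 / 4.
  by rewrite -kappa6 /a /x; field.
have e2 : a * b = - (n%:R * eps * r) + - (u * r).
  by rewrite -kappa6 /a /b /eps; field.
have e3 : b ^+ 2 / 2 = n%:R * eps ^+ 2 * r ^+ 2 / 2.
  by rewrite -kappa6 /b /eps; field.
have -> : (a * b)%:C * omega + (b ^+ 2 / 2)%:C * omega ^+ 2 =
    (- (n%:R * eps * r))%:C * omega + (n%:R * eps ^+ 2 * r ^+ 2 / 2)%:C * omega ^+ 2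
    + (- (u * r))%:C * omega.
  by rewrite e2 e3 (rmorphD _ (- (n%:R * eps * r)))/= mulrDl addrAC.
rewrite e1 cexpD cexp_real cexpD -/(ray_exp u r) -/(scaled_exp n eps r) expRD.
rewrite /scaled_integrand.
have -> : c i / expR (- (x ^+ 2 / 4)) = kappa * (kappa ^+ (3 * i) *
    (expR (- (n%:R / 2) + u ^+ 2 / (4 * kappa ^+ 2)) * expR (x ^+ 2 / 4))).
  by rewrite expRN invrK /c exprS !mulrA.
move: (expR _) (expR _) (ray_exp _ _) (scaled_exp _ _ _) (_ ^+ i) (_ ^+ _) => p q s t v w.
by rewrite !rmorphM/=; ring.
Qed.

Let Re_e : 0 <= complex.Re (kappa%:C * omega).
Proof. by rewrite cReZ Re_omega mulr_ge0// ltW. Qed.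

Let Re_lt_Im : complex.Re (kappa%:C * omega) < complex.Im (kappa%:C * omega).
Proof. by rewrite cReZ cImZ ltr_pM2l// Re_lt_Im_omega. Qed.

Let c_gt0 i : 0 < c i. Proof. by rewrite mulr_gt0 ?exprn_gt0 ?expR_gt0. Qed.

Let ratio_gt0 i : 0 < c i / expR (- (x ^+ 2 / 4)).
Proof. by rewrite divr_gt0 ?expR_gt0. Qed.

Let scaledE i r : complex.Im (scaled_integrand n eps i r * ray_exp u r * omega) =
  (c i / expR (- (x ^+ 2 / 4)))^-1 * complex.Im (hermite_integrand i x
    ((kappa ^+ 3)%:C + r%:C * (kappa%:C * omega)) * (kappa%:C * omega)).
Proof.
have q0 := lt0r_neq0 (ratio_gt0 i); apply: (mulfI q0); rewrite mulVKf//; apply: esym.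
exact: etrans (congr1 (@complex.Im R) (hermite_integrand_scaled i r)) (cImZ _ _).
Qed.

Lemma integrable_scaled i : mu.-integrable `[0, +oo[ (EFin \o
  fun r : R => complex.Im (scaled_integrand n eps i r * ray_exp u r * omega)).
Proof.
have h := contour_integrable i x (kappa ^+ 3) Re_e Re_lt_Im.
have := integrableZl _ ((c i / expR (- (x ^+ 2 / 4)))^-1) h.
move=> /(_ (measurable_itv _)); apply: eq_integrable => // r _ /=.
by rewrite -EFinM -scaledE.
Qed.

Lemma Re_hermite_scaled i : complex.Re (hermite i x) * expR (- (x ^+ 2 / 4)) =
  2 * normal_peak 1 * (c i * scaled_moment i).
Proof.
have h := contour_integrable i x (kappa ^+ 3) Re_e Re_lt_Im.
rewrite (Re_hermite_contour i x (kappa ^+ 3) Re_e Re_lt_Im).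
have -> : scaled_moment i = (c i / expR (- (x ^+ 2 / 4)))^-1 *
  \int[mu]_(r in `[0, +oo[) complex.Im (hermite_integrand i x
    ((kappa ^+ 3)%:C + r%:C * (kappa%:C * omega)) * (kappa%:C * omega)).
  rewrite -RintegralZl//; apply: eq_Rintegral => r _; exact: scaledE.
have ci := lt0r_neq0 (c_gt0 i); have E0 := lt0r_neq0 (expR_gt0 (- (x ^+ 2 / 4))).
by field; rewrite ci E0.
Qed.

End FixedDegree.
End Scaling.

(** * The limits *)

Section Oscillator.
Variable R : realType.

Definition osc_norm n : R := (Num.sqrt (n`!)%:R)^-1 * Num.sqrt ((Num.sqrt (2 * pi))^-1).

Lemma osc_norm_ge0 n : 0 <= osc_norm n.
Proof. by rewrite mulr_ge0 ?invr_ge0 ?sqrtr_ge0. Qed.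

Lemma oscillatorE n (x : R) : oscillator n x =
  osc_norm n * (complex.Re (hermite n x) * expR (- (x ^+ 2 / 4))).
Proof.
rewrite /oscillator /osc_norm sqrtrM ?invr_ge0//.
have -> : expR (- (2^-1 * x ^+ 2)) = expR (- (x ^+ 2 / 4)) ^+ 2.
  by rewrite -expRM_natl; congr expR; field.
by rewrite sqrtr_sqr ger0_norm ?expR_ge0//; ring.
Qed.

Lemma is_derive_oscillator n (x : R) : is_derive x 1 (@oscillator R n)
  (osc_norm n * (n%:R * complex.Re (hermite n.-1 x) - x / 2 * complex.Re (hermite n x))
     * expR (- (x ^+ 2 / 4))).
Proof.
rewrite (_ : @oscillator R n = fun x => osc_norm n *
  (complex.Re (hermite n x) * expR (- (x ^+ 2 / 4)))); last first.
  by apply/funext => y; exact: oscillatorE.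
have h : is_derive x 1 (fun y => - (y ^+ 2 / 4)) (- (x / 2)).
  apply: (is_derive_eq (is_deriveN (is_deriveMcst 4^-1 (is_deriveX 2 (is_derive_id x (1:R)))))).
  by rewrite expr1 /GRing.scale/=; field.
apply: (is_derive_eq (is_derive_cstM _ (is_deriveM_fun (is_derive_Re_hermite n x)
  (is_derive1_comp (is_derive_expR _) h)))).
rewrite -[RHS]mulrA /=; congr (_ * _); ring.
Qed.
End Oscillator.

Section Limit.
Variables (R : realType) (u : R).
Local Notation mu := (@lebesgue_measure R).
Local Notation omega := (omega R).

Definition kappa j : R := j.+1%:R `^ (1 / 6).
Definition lambda j : R := j.+1%:R `^ (1 / 12).
Let eps j : R := (kappa j ^+ 2)^-1.

Lemma kappa_gt0 j : 0 < kappa j. Proof. exact: powR_gt0. Qed.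
Lemma lambda_gt0 j : 0 < lambda j. Proof. exact: powR_gt0. Qed.

Lemma kappa6 j : kappa j ^+ 6 = j.+1%:R.
Proof.
rewrite -powR_mulrn ?powR_ge0// /kappa -powRrM (_ : 1 / 6 * 6%:R = 1); last by field.
by rewrite powRr1.
Qed.

Lemma lambda2 j : lambda j ^+ 2 = kappa j.
Proof.
rewrite -powR_mulrn ?powR_ge0// /lambda -powRrM /kappa; congr (_ `^ _); by field.
Qed.

Lemma sqrt_kappa3 j : Num.sqrt j.+1%:R = kappa j ^+ 3.
Proof.
rewrite -(kappa6 j) (_ : kappa j ^+ 6 = (kappa j ^+ 3) ^+ 2); last by rewrite -exprM.
by rewrite sqrtr_sqr ger0_norm// exprn_ge0// ltW// kappa_gt0.
Qed.

Lemma eps_gt0 j : 0 < eps j.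
Proof. by rewrite invr_gt0 exprn_gt0 ?kappa_gt0. Qed.

Lemma n_eps3 j : j.+1%:R * eps j ^+ 3 = 1.
Proof.
have k0 := lt0r_neq0 (kappa_gt0 j).
by rewrite -(kappa6 j) /eps; field.
Qed.

Lemma eps3 j : eps j ^+ 3 = harmonic j.
Proof. by apply: (@mulfI _ j.+1%:R); rewrite ?pnatr_eq0// n_eps3 /harmonic/= mulfV ?pnatr_eq0. Qed.

Lemma eps_le1 j : eps j <= 1.
Proof.
rewrite -(@ler_pXn2r _ 3)// ?nnegrE ?(ltW (eps_gt0 j))// expr1n eps3 /harmonic/=.
by rewrite invf_le1// ler1n.
Qed.

(** Read off from [eps ^ 3 = 1 / n]. *)
Lemma cvg_eps : eps j @[j --> \oo] --> (0 : R).
Proof.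
apply/cvgr0Pnorm_lt => e e0; have e3 : 0 < e ^+ 3 by rewrite exprn_gt0.
have h := cvgr0_norm_lt _ (@cvg_harmonic R) _ e3.
near=> j; have : `|@harmonic R j| < e ^+ 3 by near: j; exact: h.
by rewrite -eps3 normrX ltr_pXn2r// nnegrE ltW.
Unshelve. all: end_near. Qed.

Let J j i := scaled_moment j.+1 (kappa j) u i.
Let L j := \int[mu]_(r in `[0, +oo[)
  complex.Im (r%:C * omega * scaled_integrand j.+1 (eps j) j r * ray_exp u r * omega).
Let x j : R := 2 * kappa j ^+ 3 + (kappa j)^-1 * u.

(** The scalar in front of the rescaled integrals, apart from its u-dependent factor
   exp(u^2 eps / 4) *)
Let amp j : R := lambda j * osc_norm R j.+1 * (2 * normal_peak 1) *
  (kappa j ^+ (3 * j.+1).+1 * expR (- (j.+1%:R / 2))).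

(** The two moments that occur in the derivative differ by a term of order [eps],
    since their integrands differ by the factor [1 + eps r omega]. *)
Lemma moment_diff j : J j j = J j j.+1 - eps j * L j.
Proof.
have i1 := integrable_scaled u (kappa_gt0 j) (kappa6 j) j.+1.
have i2 := integrable_scaled u (kappa_gt0 j) (kappa6 j) j.
have e0 := lt0r_neq0 (eps_gt0 j).
suff -> : L j = (eps j)^-1 * (J j j.+1 - J j j) by rewrite mulVKf// opprB addrC subrK.
rewrite /J /scaled_moment -RintegralB// -(RintegralZl _ _ (integrableB _ i1 i2))//.
apply: eq_Rintegral => r _; apply: (mulfI e0); rewrite mulVKf// -cImB -cImZ.
congr complex.Im.
have -> : scaled_integrand j.+1 (eps j) j.+1 r =
    (1 + (eps j * r)%:C * omega) * scaled_integrand j.+1 (eps j) j r.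
  by rewrite /scaled_integrand exprS mulrA.
move: (scaled_integrand _ _ _ _) (ray_exp _ _) => *.
by rewrite rmorphM/=; ring.
Qed.

Lemma oscillator_scaled j : lambda j * oscillator j.+1 (x j) =
  amp j * expR (u ^+ 2 / 4 * eps j) * J j j.+1.
Proof.
rewrite oscillatorE (Re_hermite_scaled _ (kappa_gt0 j) (kappa6 j)) -/(J j j.+1).
rewrite expRD /amp /eps.
rewrite (_ : u ^+ 2 / (4 * kappa j ^+ 2) = u ^+ 2 / 4 * (kappa j ^+ 2)^-1); first by ring.
by field; rewrite lt0r_neq0 ?kappa_gt0.
Qed.

(** On the contour n w^(n-1) - (x / 2) w^n is w^n (n / w - x / 2), and n / w and
    x / 2 are both close to sqrt n: the leading terms cancel and the factor
    [r omega] of the derivative of the Airy function is what remains. *)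
Lemma derive_oscillator_scaled j : (lambda j)^-1 * (@oscillator R j.+1)^`()%classic (x j) =
  - (amp j * expR (u ^+ 2 / 4 * eps j) * (L j + u / 2 * eps j * J j j.+1)).
Proof.
have k0 := lt0r_neq0 (kappa_gt0 j); have l0 := lt0r_neq0 (lambda_gt0 j).
have [_ dE] := is_derive_oscillator j.+1 (x j).
rewrite derive1E dE /=.
have h1 := Re_hermite_scaled u (kappa_gt0 j) (kappa6 j) j.+1.
have h2 := Re_hermite_scaled u (kappa_gt0 j) (kappa6 j) j.
rewrite -/(x j) -/(J _ _) in h1; rewrite -/(x j) -/(J _ _) moment_diff in h2.
rewrite -[X in _ * X]mulrA mulrBl -[X in _ * (_ * (X - _))]mulrA h2 -[X in _ * (_ * (_ - X))]mulrA h1 /amp.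
have -> : kappa j ^+ (3 * j.+1).+1 = kappa j ^+ 3 * kappa j ^+ (3 * j).+1.
  by rewrite -exprD; congr (_ ^+ _); rewrite mulnS addnS.
rewrite !expRD.
have -> : u ^+ 2 / (4 * kappa j ^+ 2) = u ^+ 2 / 4 * eps j.
  by rewrite /eps; field.
move: (expR _) (expR _) (J j j.+1) (L j) (osc_norm _ _) (normal_peak _) (_ ^+ (3 * j).+1) => *.
rewrite -{1}(kappa6 j) /x /eps -lambda2; field.
by rewrite l0.
Qed.

(** All powers of [n] cancel; the square of [amp] is a constant over the ratio of
    Stirling's formula. *)
Lemma cvg_amp : amp j @[j --> \oo] --> (pi^-1 : R).
Proof.
pose q : R := Num.sqrt (2 * pi).
have p0 : 0 < pi :> R := pi_gt0 R.
have q0 : 0 < q by rewrite sqrtr_gt0 mulr_gt0.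
have q2 : q ^+ 2 = 2 * pi by rewrite sqr_sqrtr// mulr_ge0// ltW.
pose S j : R := (j.+1)`!%:R / (Num.sqrt j.+1%:R ^+ (j.+1).*2.+1 * expR (- j.+1%:R)).
have S0 j : 0 < S j.
  by rewrite divr_gt0 ?ltr0n ?fact_gt0// mulr_gt0 ?expR_gt0// exprn_gt0// sqrtr_gt0.
have ampE j : amp j = Num.sqrt (pi^-1 ^+ 2 * (q * (S j)^-1)).
  have a0 : 0 <= amp j.
    rewrite /amp; apply: mulr_ge0; apply: mulr_ge0; rewrite ?expR_ge0//.
    - by rewrite mulr_ge0 ?osc_norm_ge0// ltW// lambda_gt0.
    - by rewrite mulr_ge0 ?normal_peak_ge0.
    - by rewrite exprn_ge0// ltW// kappa_gt0.
  rewrite -[LHS](ger0_norm a0) -sqrtr_sqr; congr Num.sqrt.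
  have f0 : (j.+1)`!%:R != 0 :> R by rewrite pnatr_eq0 -lt0n fact_gt0.
  have k0 := lt0r_neq0 (kappa_gt0 j).
  have e0 := lt0r_neq0 (expR_gt0 (- j.+1%:R : R)).
  have peakE : normal_peak (1 : R) = q^-1.
    by rewrite /normal_peak /q expr1n mul1r mulr_natl.
  have e2 : expR (- (j.+1%:R / 2)) ^+ 2 = expR (- j.+1%:R :> R).
    by rewrite -expRM_natl; congr expR; field.
  have k2 : (kappa j ^+ (3 * j.+1).+1) ^+ 2 = kappa j ^+ (6 * j.+1) * kappa j ^+ 2.
    by rewrite -exprM -exprD; congr (_ ^+ _); rewrite mulSn mulnAC addnC.
  have SE : S j = (j.+1)`!%:R / (kappa j ^+ (6 * j.+1) * kappa j ^+ 3 * expR (- j.+1%:R)).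
    rewrite /S sqrt_kappa3 -exprM -exprD; congr (_ / (_ ^+ _ * _)).
    by rewrite mulnS -mul2n mulnA addnC.
  have s1 : Num.sqrt ((j.+1)`!%:R : R) ^+ 2 = (j.+1)`!%:R by rewrite sqr_sqrtr.
  have s2 : Num.sqrt q^-1 ^+ 2 = q^-1 by rewrite sqr_sqrtr// invr_ge0 ltW.
  have K0 : kappa j ^+ (6 * j.+1) != 0 by rewrite expf_neq0.
  have pE : pi = q ^+ 2 / 2 by rewrite q2; field.
  rewrite SE /amp /osc_norm peakE -/q pE.
  move: (kappa j ^+ (6 * j.+1)) (kappa j ^+ (3 * j.+1).+1) k2 K0 => a A k2 K0.
  move: (expR (- (j.+1%:R / 2))) e2 => B e2; move: (expR _) e2 e0 => b e2 e0.
  move: (Num.sqrt q^-1) s2 => Q s2.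
  move: (Num.sqrt _) s1 => F s1; move: ((j.+1)`!%:R) s1 f0 => f s1 f0.
  rewrite !exprMn !exprVn s1 s2 lambda2 k2 e2.
  by field; rewrite f0 K0 e0 k0 lt0r_neq0.
rewrite (_ : amp = fun j => Num.sqrt (pi^-1 ^+ 2 * (q * (S j)^-1))); last exact/funext.
rewrite [X in _ --> X](_ : _ = Num.sqrt (pi^-1 ^+ 2 * (q * q^-1))); last first.
  by rewrite mulfV ?lt0r_neq0// mulr1 sqrtr_sqr ger0_norm// invr_ge0 ltW.
have SV : (S j)^-1 @[j --> \oo] --> q^-1.
  by apply: cvgV; [exact: lt0r_neq0|exact: stirling].
have h : pi^-1 ^+ 2 * (q * (S j)^-1) @[j --> \oo] --> pi^-1 ^+ 2 * (q * q^-1).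
  by apply: cvgM; [exact: cvg_cst|apply: cvgM; [exact: cvg_cst|exact: SV]].
by apply: continuous_cvg; [exact: sqrt_continuous|exact: h].
Qed.

Lemma cvg_J : J j j.+1 @[j --> \oo] --> pi * airy u.
Proof.
rewrite airyE mulVKf ?lt0r_neq0 ?pi_gt0//.
apply: (@ray_integral_cvg R u 1 (fun j r => scaled_integrand j.+1 (eps j) j.+1 r)
  (fun r => (expR (- (r ^+ 3 / 3)))%:C)).
- by move=> j; exact: cderivable_scaled_integrand.
- move=> j r r0; rewrite mul1r.
  apply: le_trans (normc_scaled_gauss (eps_gt0 j) (n_eps3 j) (eps_le1 j) r0) _.
  by rewrite ler_peMl ?expR_ge0// -expR0 ler_expR.
- move=> r r0.
  have l0 : 2 * (eps j * r ^+ 4) @[j --> \oo] --> (0 : R).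
    have -> : 0 = 2 * (0 * r ^+ 4) :> R by rewrite mul0r mulr0.
    by apply: cvgM; [exact: cvg_cst|apply: cvgM; [exact: cvg_eps|exact: cvg_cst]].
  apply: (@squeeze_cvgr _ _ _ _ (cst 0) (fun j => 2 * (eps j * r ^+ 4)));
    [|exact: cvg_cst|exact: l0].
  by apply: nearW => j; rewrite normc_ge0/= scaled_integrand_lim ?eps_gt0 ?n_eps3.
Qed.

Lemma cvg_L : L j @[j --> \oo] --> - (pi * (@airy R)^`()%classic u).
Proof.
have [_ dE] := is_derive_airy u.
rewrite derive1E dE mulrN opprK mulVKf ?lt0r_neq0 ?pi_gt0//.
rewrite (_ : Rintegral _ _ _ = \int[mu]_(r in `[0, +oo[) complex.Im
  (r%:C * omega * (expR (- (r ^+ 3 / 3)))%:C * ray_exp u r * omega)); last first.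
  by apply: eq_Rintegral => r _; rewrite /airy_integrand !mulrA.
apply: (@ray_integral_cvg R u 1 (fun j r => r%:C * omega * scaled_integrand j.+1 (eps j) j r)
  (fun r => r%:C * omega * (expR (- (r ^+ 3 / 3)))%:C)).
- move=> j; apply: cderivableM.
    by apply: cderivableM; [exact: cderivable_id|exact: cderivable_cst].
  exact: cderivable_scaled_integrand.
- move=> j r r0; rewrite mul1r.
  rewrite (normcM _ (scaled_integrand _ _ _ _)) (normcM _ omega) normc_omega normc_real mulr1 (ger0_norm r0).
  apply: ler_pM => //; first exact: normc_ge0.
    by rewrite (le_trans _ (expR_ge1Dx _))// lerDr.
  apply: le_trans (normc_scaled_gauss (eps_gt0 j) (n_eps3 j) (eps_le1 j) r0).
  exact: normc_scaled_pred_le (eps_gt0 j) (n_eps3 j) r r0.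
- move=> r r0.
  have l0 : r * (eps j * r + 2 * (eps j * r ^+ 4)) @[j --> \oo] --> (0 : R).
    have -> : 0 = r * (0 * r + 2 * (0 * r ^+ 4)) :> R by rewrite !mul0r mulr0 addr0 mulr0.
    apply: cvgM; first exact: cvg_cst.
    apply: cvgD; first by apply: cvgM; [exact: cvg_eps|exact: cvg_cst].
    by apply: cvgM; [exact: cvg_cst|apply: cvgM; [exact: cvg_eps|exact: cvg_cst]].
  apply: (@squeeze_cvgr _ _ _ _ (cst 0) (fun j => r * (eps j * r + 2 * (eps j * r ^+ 4))));
    [|exact: cvg_cst|exact: l0].
  apply: nearW => j; rewrite normc_ge0/=.
  have c1 := scaled_integrand_pred_close (eps_gt0 j) (n_eps3 j) r0.
  have c2 := scaled_integrand_lim (eps_gt0 j) (n_eps3 j) r0.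
  have -> : r%:C * omega * scaled_integrand j.+1 (eps j) j r - r%:C * omega * (expR (- (r ^+ 3 / 3)))%:C
    = r%:C * omega * ((scaled_integrand j.+1 (eps j) j r - scaled_integrand j.+1 (eps j) j.+1 r) +
      (scaled_integrand j.+1 (eps j) j.+1 r - (expR (- (r ^+ 3 / 3)))%:C)) by ring.
  rewrite normcM (normcM _ omega) normc_omega normc_real mulr1 (ger0_norm r0) ler_wpM2l//.
  exact: le_trans (normcD _ _) (lerD c1 c2).
Qed.

Lemma cvg_factor : amp j * expR (u ^+ 2 / 4 * eps j) @[j --> \oo] --> (pi^-1 : R).
Proof.
have -> : pi^-1 = pi^-1 * expR (u ^+ 2 / 4 * 0) :> R by rewrite mulr0 expR0 mulr1.
apply: cvgM; first exact: cvg_amp.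
apply: continuous_cvg; first exact: continuous_expR.
by apply: cvgM; [exact: cvg_cst|exact: cvg_eps].
Qed.

Lemma argE j : 2 * Num.sqrt j.+1%:R + j.+1%:R `^ (- (1 / 6)) * u = x j.
Proof. by rewrite sqrt_kappa3 powRN. Qed.

Lemma cvg_oscillator :
  n%:R `^ (1 / 12) *
    oscillator n (2 * Num.sqrt n%:R + n%:R `^ (- (1 / 6)) * u)
  @[n --> \oo] --> airy u.
Proof.
have p0 : pi != 0 :> R by rewrite lt0r_neq0 ?pi_gt0.
(* At n = 0 the scale n^(1/6) vanishes; the shifted sequence has positive scales. *)
rewrite -(cvg_shiftn 1).
rewrite (_ : (fun n => _) =
    fun j => amp j * expR (u ^+ 2 / 4 * eps j) * J j j.+1); last first.
  by apply/funext => j; rewrite addn1 argE -oscillator_scaled.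
by rewrite -[airy u](mulKf p0); apply: cvgM; [exact: cvg_factor|exact: cvg_J].
Qed.

Lemma cvg_derive_oscillator :
  n%:R `^ (- (1 / 12)) * (@oscillator R n)^`()%classic
    (2 * Num.sqrt n%:R + n%:R `^ (- (1 / 6)) * u)
  @[n --> \oo] --> (@airy R)^`()%classic u.
Proof.
have p0 : pi != 0 :> R by rewrite lt0r_neq0 ?pi_gt0.
rewrite -(cvg_shiftn 1).
rewrite (_ : (fun n => _) = fun j => - (amp j * expR (u ^+ 2 / 4 * eps j) *
    (L j + u / 2 * eps j * J j j.+1))); last first.
  by apply/funext => j; rewrite addn1 argE powRN -derive_oscillator_scaled.
have -> : (@airy R)^`()%classic u =
    - (pi^-1 * (- (pi * (@airy R)^`()%classic u) + u / 2 * 0 * (pi * airy u))).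
  by rewrite mulr0 mul0r addr0 mulrN opprK mulKf.
apply: cvgN; apply: cvgM; first exact: cvg_factor.
apply: cvgD; first exact: cvg_L.
apply: cvgM; last exact: cvg_J.
by apply: cvgM; [exact: cvg_cst|exact: cvg_eps].
Qed.

End Limit.

Theorem proposition4p15 (R : realType) (u : R) :
  (n%:R `^ (1 / 12) *
     oscillator n (2 * Num.sqrt n%:R + n%:R `^ (- (1 / 6)) * u)
     @[n --> \oo] --> airy u) /\
  (n%:R `^ (- (1 / 12)) *
     (@oscillator R n)^`()%classic
       (2 * Num.sqrt n%:R + n%:R `^ (- (1 / 6)) * u)
     @[n --> \oo] --> (@airy R)^`()%classic u).
Proof. by split; [exact: cvg_oscillator|exact: cvg_derive_oscillator]. Qed.
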